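(* Let $n\ge 2$. For all $k\in\mathbb{N}$, the functional $\mathcal{V}^1_k=\mathcal{W}_{k,k}$ on $\mathcal{C}^n$ is (a) invariant under rigid motions: $\mathcal{W}_{k,k}(\varphi(K))=\mathcal{W}_{k,k}(K)$ for every $K\in\mathcal{C}^n$ and every rigid motion $\varphi$ of $\mathbb{R}^n$; (b) homogeneous of degree $n\frac{n-1}{n+1}-k$: $\mathcal{W}_{k,k}(aK)=a^{n\frac{n-1}{n+1}-k}\,\mathcal{W}_{k,k}(K)$ for every $K\in\mathcal{C}^n$ and every $a>0$; (c) a valuation on $\mathcal{C}^n$.
   Context: $\mathbb{N}=\{1,2,\dots\}$. A convex body is a compact convex subset of $\mathbb{R}^n$ with nonempty interior; $\mathcal{K}^n_o$ is the set of convex bodies in $\mathbb{R}^n$ containing the origin in their interior. For a convex body $K$ and $x\in\partial K$, $N(x)$ is the outer unit normal of $K$ at $x$ (unique for $\mathcal{H}^{n-1}$-almost all $x$), $k_1(x),\dots,k_{n-1}(x)$ are the (generalized) principal curvatures, which exist for $\mathcal{H}^{n-1}$-almost all $x\in\partial K$, and $H_j=\binom{n-1}{j}^{-1}\sum_{1\le i_1<\dots<i_j\le n-1}k_{i_1}\cdots k_{i_j}$ for $1\le j\le n-1$. $\mathcal{H}^{n-1}$ is the surface area measure on $\partial K$. $B^n_2(y,r)$ is the closed Euclidean ball with center $y$ and radius $r$. $K$ admits an inner rolling ball if there is $r>0$ with $B^n_2(x-rN(x),r)\subseteq K$ for every $x\in\partial K$, and an outer rolling ball if there is $R>0$ with $K\subseteq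 B^n_2(x-RN(x),R)$ for every $x\in\partial K$ (where $N(x)$ is an outer unit normal at $x$). $\mathcal{C}^n$ is the set of $K\in\mathcal{K}^n_o$ admitting both an inner and an outer rolling ball. For $\alpha\in\mathbb{R}$: $\binom{\alpha}{0}=1$, $\binom{\alpha}{k}=\frac{\alpha(\alpha-1)\cdots(\alpha-k+1)}{k!}$ for integers $k>0$. For non-negative integers $i_1,\dots,i_{n-1}$ with $i_1+2i_2+\dots+(n-1)i_{n-1}=m$ put $$c(n,p,i(m))=\binom{\frac{n}{n+p}}{i_1+\dots+i_{n-1}}\frac{(i_1+\dots+i_{n-1})!}{i_1!\,i_2!\cdots i_{n-1}!}.$$ For real $p\ne -n$ and integers $k,m\ge 0$, $$\mathcal{W}^p_{m,k}(K)=\int_{\partial K}\langle x,N(x)\rangle^{m-k+\frac{n(1-p)}{n+p}}H_{n-1}^{\frac{p}{n+p}}\sum_{\substack{i_1,\dots,i_{n-1}\ge 0\\ i_1+2i_2+\dots+(n-1)i_{n-1}=m}}c(n,p,i(m))\prod_{j=1}^{n-1}\binom{n-1}{j}^{i_j}H_j^{i_j}\,d\mathcal{H}^{n-1},$$ and $\mathcal{V}^p_k(K)=\sum_{m=0}^{k}\binom{\frac{n(1-p)}{n+p}}{k-m}\mathcal{W}^p_{m,k}(K)$. For $p=1$ this becomes $\mathcal{V}^1_k=\mathcal{W}^1_{k,k}=:\mathcal{W}_{k,k}$, where $$\mathcal{W}_{k,k}(K)=\int_{\partial K}H_{n-1}^{\frac{1}{n+1}}\sum_{\substack{i_1,\dots,i_{n-1}\ge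 0\\ i_1+2i_2+\dots+(n-1)i_{n-1}=k}}c(n,1,i(k))\prod_{j=1}^{n-1}\binom{n-1}{j}^{i_j}H_j^{i_j}\,d\mathcal{H}^{n-1};$$ this last formula does not involve the position of the origin and is used as the definition of $\mathcal{W}_{k,k}(\varphi(K))$ for any rigid motion $\varphi$. Rigid motions are compositions of translations, rotations and reflections of $\mathbb{R}^n$. A functional $\mu$ is a valuation on $\mathcal{C}^n$ if $\mu(K\cup L)+\mu(K\cap L)=\mu(K)+\mu(L)$ for all $K,L\in\mathcal{C}^n$ with $K\cup L$ convex. *)

(* Defs.v *)
From HB Require Import structures.
From mathcomp Require Import all_boot all_order all_algebra.
From mathcomp Require Import all_classical all_reals all_analysis.

Set Implicit Arguments.
Unset Strict Implicit.
Unset Printing Implicit Defensive.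

Import Order.TTheory GRing.Theory Num.Theory.
Import numFieldNormedType.Exports.

Local Open Scope classical_set_scope.
Local Open Scope ring_scope.

(* R^n is 'rV[R]_n. Its library norm is the sup norm: it is used here only
   through the topology it induces, all metric notions being based on enorm. *)
Section euclidean.
Context {R : realType} {n : nat}.
Implicit Types (x y u : 'rV[R]_n) (K : set 'rV[R]_n).

Definition dot x y : R := (x *m y^T) ord0 ord0.

Definition enorm x : R := Num.sqrt (dot x x).

Definition eball x (r : R) : set 'rV[R]_n := [set y | enorm (y - x) <= r].

Definition boundary K : set 'rV[R]_n := closure K `\` K°.

(* Rotations and reflections fix the origin; those with another centre are
   obtained by composing with translations. *)
Inductive rigid_motion : ('rV[R]_n -> 'rV[R]_n) -> Prop :=
| Translation b : rigid_motion (fun x => x + b)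
| Rotation (A : 'M[R]_n) of A *m A^T = 1%:M & \det A = 1 :
    rigid_motion (fun x => x *m A)
| Reflection u of enorm u = 1 : rigid_motion (fun x => x - (2 * dot x u) *: u)
| Composition f g of rigid_motion f & rigid_motion g : rigid_motion (f \o g).

End euclidean.

Section hausdorff.
Context (R : realType) (n s : nat).
Implicit Types (A B : set 'rV[R]_n).
Local Open Scope ereal_scope.

(* Volume of the Euclidean unit ball of R^m. *)
Fixpoint ball_volume (m : nat) : R :=
  match m with
  | 0 => 1
  | 1 => 2
  | m'.+2 => 2 * pi / m'.+2%:R * ball_volume m'
  end.

Definition ediam A : \bar R :=
  ereal_sup [set (enorm (xy.1 - xy.2))%:E | xy in A `*` A].

(* The empty set needs its own clause: its ediam is -oo. *)
Definition hausdorff_gauge A : \bar R :=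
  if `[< A = set0 >] then 0
  else (ball_volume s / 2 ^+ s)%:E * ediam A ^+ s.

Definition hausdorff_delta (d : R) A : \bar R :=
  ereal_inf [set \sum_(k <oo) hausdorff_gauge (E k) | E in
    [set E : (set 'rV[R]_n)^nat |
      A `<=` \bigcup_k E k /\ forall k, ediam (E k) <= d%:E]].

(* The s-dimensional Hausdorff outer measure, normalized so that it is the
   Lebesgue measure when s = n. *)
Definition hausdorff A : \bar R :=
  ereal_sup [set hausdorff_delta d A | d in [set d : R | (0 < d)%R]].

Lemma ball_volume_ge0 m : (0 <= ball_volume m)%R.
Proof.
have [k] := ubnP m; elim: k m => // k IH [|[|m]] //= mk.
rewrite mulr_ge0 ?IH//; last by rewrite -ltnS (leq_trans _ mk)// leqW.
by rewrite mulr_ge0 ?invr_ge0 ?ler0n// mulr_ge0// pi_ge0.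
Qed.

Lemma ediam_ge0 A : A !=set0 -> 0 <= ediam A.
Proof.
move=> [x Ax]; apply: ereal_sup_ubound; exists (x, x) => //=.
by rewrite subrr /enorm /dot mul0mx mxE sqrtr0.
Qed.

Lemma hausdorff_gauge_ge0 A : 0 <= hausdorff_gauge A.
Proof.
rewrite /hausdorff_gauge; case: asboolP => // /eqP/set0P A0.
rewrite mule_ge0 ?expe_ge0 ?ediam_ge0// lee_fin.
by rewrite mulr_ge0 ?ball_volume_ge0// invr_ge0 exprn_ge0.
Qed.

Lemma hausdorff_gauge0 : hausdorff_gauge set0 = 0.
Proof. by rewrite /hausdorff_gauge; case: asboolP. Qed.

Lemma ediam0 : ediam set0 = -oo.
Proof. by rewrite /ediam set0X image_set0 ereal_sup0. Qed.

Lemma hausdorff_delta_ge0 d A : 0 <= hausdorff_delta d A.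
Proof.
by apply: le_ereal_inf_tmp => _ [E _ <-]; apply: nneseries_ge0 => *;
  exact: hausdorff_gauge_ge0.
Qed.

Lemma hausdorff_delta0 d : hausdorff_delta d set0 = 0.
Proof.
apply/eqP; rewrite eq_le hausdorff_delta_ge0 andbT.
apply: ereal_inf_lbound; exists (fun=> set0).
  by split=> // k; rewrite ediam0 leNye.
by apply: eseries0 => *; exact: hausdorff_gauge0.
Qed.

Lemma le_hausdorff_delta d A B :
  A `<=` B -> hausdorff_delta d A <= hausdorff_delta d B.
Proof.
move=> AB; apply: ereal_inf_le_tmp => _ [E [BE dE] <-]; exists E => //.
by split=> //; exact: subset_trans BE.
Qed.

Lemma hausdorff_delta_sigma_subadditive d :
  sigma_subadditive (hausdorff_delta d).
Proof.
move=> A; have [[i ioo]|] := pselect (exists i, hausdorff_delta d (A i) = +oo).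
  rewrite (eseries_pinfty _ _ ioo) ?leey// => j _.
  by rewrite -ltNye (lt_le_trans _ (hausdorff_delta_ge0 _ _)).
rewrite -forallNE => Aoo.
suff add2e (e : {posnum R}) : hausdorff_delta d (\bigcup_i A i) <=
    \sum_(i <oo) hausdorff_delta d (A i) + e%:num%:E.
  by apply/lee_addgt0Pr => _/posnumP[].
rewrite (le_trans _ (epsilon_trick _ _ _))//; last first.
  by move=> i; exact: hausdorff_delta_ge0.
pose P i (E : (set 'rV[R]_n)^nat) :=
  [/\ A i `<=` \bigcup_k E k, forall k, ediam (E k) <= d%:E &
  \sum_(k <oo) hausdorff_gauge (E k) <=
    hausdorff_delta d (A i) + (e%:num / (2 ^ i.+1)%:R)%:E].
have [G PG] : {G : nat -> (set 'rV[R]_n)^nat & forall i, P i (G i)}.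
  apply: (@choice _ _ P) => i; rewrite /P.
  have en1 : (0 < e%:num / (2 ^ i.+1)%:R)%R by [].
  have Afin : hausdorff_delta d (A i) \is a fin_num.
    by rewrite ge0_fin_numE ?hausdorff_delta_ge0// ltey; apply/eqP/Aoo.
  have [x [E [AE dE] <-] /ltW] := lb_ereal_inf_adherent en1 Afin.
  by exists E.
have G_ge0 x : 0 <= (hausdorff_gauge \o uncurry G) x.
  exact: hausdorff_gauge_ge0.
apply: (@le_trans _ _ (\esum_(i in setT) (hausdorff_gauge \o uncurry G) i)).
  apply: ereal_inf_lbound => /=.
  have /card_esym/ppcard_eqP[f] := card_nat2.
  exists (uncurry G \o f).
    split=> [x [i _ Aix]|k /=]; last by case: (f k) => i j; have [_ /(_ j)] := PG i.
    have [/(_ _ Aix)[j _ Gx] _ _] := PG i.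
    by exists (f^-1%FUN (i, j)) => //=; rewrite invK ?inE.
  rewrite -(esum_pred_image (hausdorff_gauge \o uncurry G) _ xpredT)
    ?[fun=> _]set_true//.
  by rewrite image_eq.
rewrite (_ : esum _ _ = \sum_(i <oo) \sum_(j <oo) hausdorff_gauge (G i j));
  last first.
  pose J : nat -> set (nat * nat) := fun i => [set (i, j) | j in setT].
  rewrite (_ : setT = \bigcup_k J k); last first.
    by rewrite predeqE => -[a b]; split => // _; exists a => //; exists b.
  rewrite esum_bigcupT /=; last 2 first.
    - apply/trivIsetP => i j _ _ ij.
      rewrite predeqE => -[x y] /=; split => //= -[] [_] _ [<-{x} _].
      by move=> [y' _] [] /esym/eqP; rewrite (negbTE ij).
    - by move=> [x y]; exact: hausdorff_gauge_ge0.
  rewrite -(image_id [set: nat]) -fun_true esum_pred_image//; last first.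
    by move=> i _; apply: esum_ge0 => -[a b] _; exact: hausdorff_gauge_ge0.
  apply: eq_eseriesr => /= j _.
  rewrite -(esum_pred_image (hausdorff_gauge \o uncurry G) (pair j) predT)/=;
    last 2 first.
    - by move=> i _; exact: hausdorff_gauge_ge0.
    - by move=> ? ? _ _; exact: (@can_inj _ _ _ snd).
  by congr esum; rewrite predeqE => -[a b]; split; move=> [i _ <-]; exists i.
apply: lee_nneseries => [i _ _|i _]; last by case: (PG i).
by apply: nneseries_ge0 => j *; exact: hausdorff_gauge_ge0.
Qed.

Lemma hausdorff_ge0 A : 0 <= hausdorff A.
Proof.
apply: (le_trans (hausdorff_delta_ge0 1 A)).
by apply: ereal_sup_ubound; exists 1%R => //=; rewrite ltr01.
Qed.

Lemma hausdorff0 : hausdorff set0 = 0.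
Proof.
apply/eqP; rewrite eq_le hausdorff_ge0 andbT.
by apply: ge_ereal_sup => _ [d _ <-]; rewrite hausdorff_delta0.
Qed.

Lemma le_hausdorff : {homo hausdorff : A B / A `<=` B >-> A <= B}.
Proof.
move=> A B AB; apply: ge_ereal_sup => _ [d d0 <-].
apply: (le_trans (le_hausdorff_delta d AB)).
by apply: ereal_sup_ubound; exists d.
Qed.

Lemma hausdorff_sigma_subadditive : sigma_subadditive hausdorff.
Proof.
move=> A; apply: ge_ereal_sup => _ [d d0 <-].
apply: (le_trans (hausdorff_delta_sigma_subadditive d A)).
apply: lee_nneseries => [i _ _|i _]; first exact: hausdorff_delta_ge0.
by apply: ereal_sup_ubound; exists d.
Qed.

HB.instance Definition _ := isOuterMeasure.Build R 'rV[R]_n hausdorff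
  hausdorff0 hausdorff_ge0 le_hausdorff hausdorff_sigma_subadditive.

(* The measure obtained by restricting it to its Caratheodory sigma-algebra,
   which contains the Borel sets. *)
Definition hausdorff_measure : set (caratheodory_type hausdorff) -> \bar R :=
  hausdorff.

HB.instance Definition _ := isMeasure.Build _ (caratheodory_type hausdorff) R
  hausdorff_measure
  (@caratheodory_measure0 _ _ hausdorff) (@caratheodory_measure_ge0 _ _ hausdorff)
  (@caratheodory_measure_sigma_additive _ _ hausdorff).

End hausdorff.
Arguments hausdorff {R n} s A.
Arguments hausdorff_measure {R n} s A.

Section convex_bodies.
Context {R : realType} {n : nat}.
Implicit Types (x u : 'rV[R]_n) (K L : set 'rV[R]_n).

Definition convex_body K :=
  [/\ compact K, convex_set (K : set (convex_lmodType 'rV[R]_n)) &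
      K° !=set0].

Definition outer_unit_normal K x u :=
  enorm u = 1 /\ forall y, K y -> dot (y - x) u <= 0.

(* An arbitrary outer unit normal where it is not unique. *)
Definition gauss_map K x : 'rV[R]_n := xget 0 [set u | outer_unit_normal K x u].

Definition inner_rolling_ball K := exists2 r : R, 0 < r &
  forall x, boundary K x -> exists2 u, outer_unit_normal K x u &
    eball (x - r *: u) r `<=` K.

Definition outer_rolling_ball K := exists2 r : R, 0 < r &
  forall x, boundary K x -> exists2 u, outer_unit_normal K x u &
    K `<=` eball (x - r *: u) r.

(* The class C^n. *)
Definition rolling_body K :=
  [/\ convex_body K, K° 0, inner_rolling_ball K & outer_rolling_ball K].

(* Near x, the boundary of K is the graph of f over the hyperplane x + u^⊥,
   heights being measured in the inner direction -u. *)
Definition boundary_graph K x u (f : 'rV[R]_n -> R) :=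
  \forall h \near (0 : 'rV[R]_n), dot h u = 0 ->
    K (x + h - f h *: u) /\ forall t, K (x + h - t *: u) -> f h <= t.

(* f(h) = <hA, h> / 2 + o(|h|^2) as h tends to 0 in u^⊥. *)
Definition second_order u (f : 'rV[R]_n -> R) (A : 'M[R]_n) :=
  forall e : R, 0 < e -> \forall h \near (0 : 'rV[R]_n), dot h u = 0 ->
    `|f h - 2^-1 * dot (h *m A) h| <= e * dot h h.

(* k lists the generalized principal curvatures of K at x: A is the second
   fundamental form on u^⊥, extended by 0 along u, which accounts for the
   factor 'X; the k i are its remaining eigenvalues, with multiplicity. *)
Definition is_principal_curvatures K x (k : 'I_n.-1 -> R) :=
  exists u f A, [/\ outer_unit_normal K x u, boundary_graph K x u f,
    second_order u f A, A^T = A /\ u *m A = 0 &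
    char_poly A = 'X * \prod_i ('X - (k i)%:P)].

(* They are determined only up to order, and set to 0 where they do not
   exist. *)
Definition principal_curvatures K x : 'I_n.-1 -> R :=
  xget (fun=> 0) [set k | is_principal_curvatures K x k].

(* The normalized elementary symmetric functions H_j of the curvatures. *)
Definition mean_curvature K (j : nat) x : R :=
  'C(n.-1, j)%:R^-1 * \sum_(I : {set 'I_n.-1} | #|I| == j)
    \prod_(i in I) principal_curvatures K x i.

Definition is_valuation (C : set (set 'rV[R]_n)) (mu : set 'rV[R]_n -> \bar R) :=
  forall K L, C K -> C L ->
    convex_set (K `|` L : set (convex_lmodType 'rV[R]_n)) ->
    (mu (K `|` L) + mu (K `&` L) = mu K + mu L)%E.

End convex_bodies.

Section steiner_coefficients.
Context {R : realType} {n : nat}.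
Implicit Types (K : set 'rV[R]_n) (p : R).

Definition gen_binom (a : R) (k : nat) : R :=
  (\prod_(i < k) (a - i%:R)) / k`!%:R.

(* Indices are shifted: i j stands for i_(j+1), with j = 0, ..., n-2. *)
Definition coef_c p (i : 'I_n.-1 -> nat) : R :=
  gen_binom (n%:R / (n%:R + p)) (\sum_j i j)%N *
  ((\sum_j i j)%N`!%:R / (\prod_j (i j)`!)%N%:R).

(* The constraint forces every index to be at most m, so that they can be
   taken in 'I_m.+1. *)
Definition curvature_sum p (m : nat) K (x : 'rV[R]_n) : R :=
  \sum_(i : {ffun 'I_n.-1 -> 'I_m.+1} |
      (\sum_(j < n.-1) j.+1 * i j == m)%N)
    coef_c p (fun j => i j) *
    \prod_(j < n.-1)
      ('C(n.-1, j.+1)%:R ^+ i j * mean_curvature K j.+1 x ^+ i j).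

Definition quermass_W p (m k : nat) K : \bar R :=
  (\int[@hausdorff_measure R n n.-1]_(x in boundary K)
    (dot x (gauss_map K x) `^ (m%:R - k%:R + n%:R * (1 - p) / (n%:R + p)) *
     mean_curvature K n.-1 x `^ (p / (n%:R + p)) *
     curvature_sum p m K x)%:E)%E.

Definition steiner_V p (k : nat) K : \bar R :=
  (\sum_(m < k.+1) (gen_binom (n%:R * (1 - p) / (n%:R + p)) (k - m))%:E *
    quermass_W p m k K)%E.

(* The functional W_{k,k} (case p = 1), by the formula which does not involve
   the position of the origin. *)
Definition quermass_W1 (k : nat) K : \bar R :=
  (\int[@hausdorff_measure R n n.-1]_(x in boundary K)
    (mean_curvature K n.-1 x `^ (1 / (n%:R + 1)) *
     curvature_sum 1 k K x)%:E)%E.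

End steiner_coefficients.

(* Main.v *)
Require Import Defs.
From HB Require Import structures.
From mathcomp Require Import all_boot all_order all_fingroup all_algebra.
From mathcomp Require Import all_classical all_reals all_analysis.
From mathcomp Require Import ring lra zify.
Import Order.TTheory GRing.Theory Num.Theory.
Import numFieldNormedType.Exports.
Local Open Scope classical_set_scope.
Local Open Scope ring_scope.

(** For p = 1 all the binomial factors of [steiner_V] vanish except the last,
and the power of <x, N(x)> in its last term is 1, which leaves [quermass_W1]
([steiner_V1E]).

Rigid motions and dilations are both maps x |-> a (x Q) + b with Q orthogonal.
Such a map multiplies the (n-1)-dimensional Hausdorff measure by a^(n-1) and
carries the lists of principal curvatures at x to those at the image point,
divided by a.  The list is only defined up to a choice, but at a boundary point
touched by an inner ball the choice does not affect the elementary symmetric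
functions: the normal is unique, hence so is the local graph, hence so is its
second-order form, hence so is the multiset of eigenvalues
([principal_curvatures_unique]).  The integrand of W_{k,k} therefore scales
by a^(-(n-1)/(n+1) - k), which gives invariance and homogeneity
([quermass_W1_similitude]).

For the valuation property let U and I be the union and the intersection of K
and L, and let C be the set of common boundary points of K and L.  Near a
boundary point x of K or of L outside C, exactly one of U and I has x on its
boundary, and it coincides there with the body at hand; curvature is local for
convex sets ([principal_curvatures_local]), so outside C the integrands of
(U, I) are those of (K, L), possibly exchanged.  At a point c of C the two
bodies have the same normal, since inner balls in two directions would put c in
the interior of U, while the ray from the origin through c leaves U at c.  So a
ball contained in I and a half-space containing U touch at c, and all four
bodies lie between them.  Let x in C be such that C approximates every tangent
vector h at x within o(|h|) ([tangentially_dense]).  The contact point next to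
x + h confines the boundaries of all four bodies above x + h to a layer of
thickness o(|h|^2), so at x one of them has a second-order expansion if and
only if they all have the same one, and the four integrands agree
([sandwich_principal_curvatures]).

The remaining points of C form a null set ([not_tangentially_dense_null]).
Where the i-th coordinate of the normal is bounded away from 0, forgetting the
i-th coordinate is bi-Lipschitz on C, and the image is porous at the exceptional
points: it has holes of relative size bounded below at arbitrarily small scales.
Porous sets are null ([porous_hausdorff_eq0]): the maximal dyadic cells missing
the set have finite total volume, and the set is covered by enlargements, by a
fixed factor, of those of late generation.

The integral is a difference of suprema over simple functions, and both the
change of variables ([integral_scale]) and the exchange of integrands
([integral_swap]) are proved directly for these suprema, for arbitrary
integrands.  What the exchange needs is a measurable set on which to exchange;
it is built from closed sets, which are Caratheodory measurable for the
Hausdorff outer measure because that one is additive on sets at positive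
distance ([closed_caratheodory]). *)

(** * The Euclidean norm and the topology of row vectors *)

Section euclidean_geometry.
Context {R : realType} {n : nat}.
Implicit Types (x y z u v : 'rV[R]_n) (K : set 'rV[R]_n).

Lemma dotE x y : dot x y = \sum_k x ord0 k * y ord0 k.
Proof. by rewrite /dot mxE; apply: eq_bigr => k _; rewrite mxE. Qed.

Lemma dotC x y : dot x y = dot y x.
Proof. by rewrite !dotE; apply: eq_bigr => k _; rewrite mulrC. Qed.

Lemma dotDl x y z : dot (x + y) z = dot x z + dot y z.
Proof. by rewrite /dot mulmxDl mxE. Qed.

Lemma dotDr x y z : dot z (x + y) = dot z x + dot z y.
Proof. by rewrite dotC dotDl !(dotC z). Qed.

Lemma dotZl (a : R) x z : dot (a *: x) z = a * dot x z.
Proof. by rewrite /dot -scalemxAl mxE. Qed.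

Lemma dotZr (a : R) x z : dot z (a *: x) = a * dot z x.
Proof. by rewrite dotC dotZl dotC. Qed.

Lemma dotNl x z : dot (- x) z = - dot x z.
Proof. by rewrite -scaleN1r dotZl mulN1r. Qed.

Lemma dotNr x z : dot z (- x) = - dot z x.
Proof. by rewrite dotC dotNl dotC. Qed.

Lemma dotBl x y z : dot (x - y) z = dot x z - dot y z.
Proof. by rewrite dotDl dotNl. Qed.

Lemma dotBr x y z : dot z (x - y) = dot z x - dot z y.
Proof. by rewrite dotDr dotNr. Qed.

Lemma dot0l z : dot 0 z = 0.
Proof. by rewrite /dot mul0mx mxE. Qed.

Lemma dot0r z : dot z 0 = 0.
Proof. by rewrite dotC dot0l. Qed.

Definition dot_linear := (dotDl, dotDr, dotBl, dotBr, dotNl, dotNr, dotZl, dotZr,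
  dot0l, dot0r).

Lemma dot_mulmx (m : nat) (x : 'rV[R]_n) (y : 'rV[R]_m) (A : 'M[R]_(n, m)) :
  dot (x *m A) y = dot x (y *m A^T).
Proof. by rewrite /dot trmx_mul trmxK mulmxA. Qed.

Lemma dot_ge0 x : 0 <= dot x x.
Proof. by rewrite dotE sumr_ge0 // => k _; rewrite -expr2 sqr_ge0. Qed.

Lemma enorm_ge0 x : 0 <= enorm x.
Proof. exact: sqrtr_ge0. Qed.

Lemma enorm_sq x : enorm x ^+ 2 = dot x x.
Proof. by rewrite sqr_sqrtr // dot_ge0. Qed.

Lemma enorm_lt x (e : R) : 0 < e -> (enorm x < e) = (dot x x < e ^+ 2).
Proof. by move=> e0; rewrite -enorm_sq ltr_pXn2r // nnegrE ?enorm_ge0 // ltW. Qed.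

Lemma enorm_le x (e : R) : 0 <= e -> (enorm x <= e) = (dot x x <= e ^+ 2).
Proof. by move=> e0; rewrite -enorm_sq ler_pXn2r // nnegrE ?enorm_ge0. Qed.

Lemma coord_le_enorm x k : `|x ord0 k| <= enorm x.
Proof.
rewrite -(@ler_pXn2r _ 2) ?nnegrE ?enorm_ge0 // enorm_sq dotE (bigD1 k) //=.
by rewrite real_normK ?num_real // -expr2 lerDl sumr_ge0 // => i _; rewrite -expr2 sqr_ge0.
Qed.

Lemma dot_eq0 x : (dot x x == 0) = (x == 0).
Proof.
apply/eqP/eqP => [x0|->]; last exact: dot0l.
apply/rowP => k; rewrite mxE; apply/eqP; rewrite -normr_le0.
by rewrite (le_trans (coord_le_enorm x k)) // /enorm x0 sqrtr0.
Qed.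

Lemma enorm0 : enorm (0 : 'rV[R]_n) = 0.
Proof. by rewrite /enorm dot0l sqrtr0. Qed.

Lemma enormZ (a : R) x : enorm (a *: x) = `|a| * enorm x.
Proof. by rewrite /enorm !dot_linear mulrA -expr2 sqrtrM ?sqr_ge0 // sqrtr_sqr. Qed.

Lemma enormN x : enorm (- x) = enorm x.
Proof. by rewrite /enorm !dot_linear opprK. Qed.

Lemma enormB x y : enorm (x - y) = enorm (y - x).
Proof. by rewrite -enormN opprB. Qed.

(** Cauchy-Schwarz: expand the square of |y|^2 x - <x,y> y. *)
Lemma dot_le x y : dot x y <= enorm x * enorm y.
Proof.
have [y0|y0] := eqVneq (dot y y) 0.
  have /eqP -> : y == 0 by rewrite -dot_eq0 y0.
  by rewrite dot0r enorm0 mulr0.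
have ygt0 : 0 < dot y y by rewrite lt_neqAle eq_sym y0 dot_ge0.
have [xy0|xy0] := leP (dot x y) 0.
  by rewrite (le_trans xy0) // mulr_ge0 // enorm_ge0.
rewrite -(@ler_pXn2r _ 2) ?nnegrE ?mulr_ge0 ?enorm_ge0 // ?(ltW xy0) //.
rewrite exprMn !enorm_sq.
have := dot_ge0 (dot y y *: x - dot x y *: y).
rewrite !dot_linear (dotC y x) => h.
have {}h : 0 <= dot y y * (dot x x * dot y y - dot x y ^+ 2) by apply: le_trans h _; nra.
by rewrite pmulr_rge0 // subr_ge0 in h.
Qed.

Lemma dot_abs_le x y : `|dot x y| <= enorm x * enorm y.
Proof. by rewrite ler_norml dot_le andbT lerNl -dotNl (le_trans (dot_le _ _)) // enormN. Qed.

Lemma enormD x y : enorm (x + y) <= enorm x + enorm y.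
Proof.
rewrite enorm_le ?addr_ge0 ?enorm_ge0 // sqrrD !enorm_sq !dot_linear (dotC y x).
by have := dot_le x y; nra.
Qed.

Lemma enorm_sum (I : finType) (F : I -> 'rV[R]_n) :
  enorm (\sum_i F i) <= \sum_i enorm (F i).
Proof.
elim/big_ind2 : _ => [|u a v b ua vb|//]; first by rewrite enorm0.
by rewrite (le_trans (enormD _ _)) // lerD.
Qed.

Lemma enorm_le_sum x : enorm x <= \sum_k `|x ord0 k|.
Proof.
have s0 (I : seq 'I_n) : 0 <= \sum_(k <- I) `|x ord0 k| by rewrite sumr_ge0.
rewrite enorm_le // dotE.
elim: (index_enum _) => [|i I ih]; first by rewrite !big_nil expr0n.
rewrite !big_cons; have := s0 I; have := normr_ge0 (x ord0 i).
have -> : x ord0 i * x ord0 i = `|x ord0 i| ^+ 2 by rewrite real_normK ?num_real // expr2.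
by move: ih; set a := \sum_(j <- I) _ * _; set b := \sum_(j <- I) `|_|; nra.
Qed.

(** The library topology on row vectors is that of the sup norm, which is
equivalent to the Euclidean norm. *)
Lemma nbhs_enormP x (A : set 'rV[R]_n) :
  nbhs x A <-> exists2 e : R, 0 < e & forall y, enorm (y - x) < e -> A y.
Proof.
split.
  move=> /nbhs_ballP[e /= e0 xA]; exists e => // y yx; apply: xA.
  split=> // i j; rewrite (ord1 i) -ball_normE /=.
  apply: le_lt_trans yx; rewrite enormB.
  by apply: le_trans _ (coord_le_enorm _ j); rewrite !mxE.
move=> [e e0 xA]; apply/nbhs_ballP; exists (e / n.+1%:R); first by rewrite /= divr_gt0.
move=> y [_ yx]; apply: xA; apply: le_lt_trans (enorm_le_sum _) _.
apply: (@le_lt_trans _ _ (\sum_(k < n) e / n.+1%:R)).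
  apply: ler_sum => k _; rewrite !mxE distrC; apply/ltW.
  by have := yx ord0 k; rewrite -ball_normE /=; apply.
rewrite sumr_const card_ord -[X in X < _]mulr_natr -mulrA gtr_pMr // mulrC.
by rewrite ltr_pdivrMr // mul1r ltr_nat.
Qed.

Lemma interior_enormP x K :
  K° x <-> exists2 e : R, 0 < e & forall y, enorm (y - x) < e -> K y.
Proof. exact: nbhs_enormP. Qed.

Lemma closure_enormP x K :
  closure K x <-> forall e : R, 0 < e -> exists2 y, K y & enorm (y - x) < e.
Proof.
split=> [cK e e0|h B /nbhs_enormP[e e0 eB]].
  have /cK[y [Ky ye]] : nbhs x [set y | enorm (y - x) < e] by apply/nbhs_enormP; exists e.
  by exists y.
by have [y Ky /eB By] := h e e0; exists y.
Qed.

End euclidean_geometry.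

(** * Covers and Hausdorff measure *)

Section hausdorff_covers.
Context {R : realType} {n : nat} (s : nat).
Implicit Types A E : set 'rV[R]_n.
Local Open Scope ereal_scope.

HB.instance Definition _ (d : R) := isOuterMeasure.Build R 'rV[R]_n
  (@hausdorff_delta R n s d) (@hausdorff_delta0 R n s d) (@hausdorff_delta_ge0 R n s d)
  (@le_hausdorff_delta R n s d) (@hausdorff_delta_sigma_subadditive R n s d).

Lemma hausdorff_delta_le_gauge (d : R) E :
  ediam E <= d%:E -> @hausdorff_delta R n s d E <= hausdorff_gauge s E.
Proof.
move=> Ed; apply: ereal_inf_lbound.
exists (fun k => if k == 0%N then E else set0).
  split; first by move=> x Ex; exists 0%N.
  by case=> //= _; rewrite ediam0 leNye.
rewrite (nneseries_recl (P := xpredT)) //=; last by move=> *; exact: hausdorff_gauge_ge0.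
by rewrite eseries0 ?adde0 // => -[|k] //= _ _; rewrite hausdorff_gauge0.
Qed.

Lemma ediam_le E (r : R) :
  (forall x y, E x -> E y -> (enorm (x - y) <= r)%R) -> ediam E <= r%:E.
Proof. by move=> h; apply: ge_ereal_sup => _ [[x y] [/= Ex Ey] <-]; rewrite lee_fin h. Qed.

(** The factor that turns the s-th power of a diameter into a gauge. *)
Definition gauge_cst : R := (ball_volume R s / 2 ^+ s)%R.

Lemma gauge_cst_ge0 : (0 <= gauge_cst)%R.
Proof. by rewrite mulr_ge0 ?ball_volume_ge0 // invr_ge0 exprn_ge0. Qed.

Lemma hausdorff_gauge_le E (r : R) : (0 <= r)%R -> ediam E <= r%:E ->
  hausdorff_gauge s E <= (gauge_cst * r ^+ s)%:E.
Proof.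
move=> r0 Er; rewrite /hausdorff_gauge; case: asboolP => [_|E0].
  by rewrite lee_fin mulr_ge0 ?gauge_cst_ge0 ?exprn_ge0.
have [x Ex] : E !=set0 by apply/set0P/eqP.
rewrite [leRHS]EFinM -/gauge_cst; apply: lee_pmul => //; first by rewrite lee_fin gauge_cst_ge0.
  by rewrite expe_ge0 // ediam_ge0 //; exists x.
have : 0 <= ediam E by apply: ediam_ge0; exists x.
move: Er; case: (ediam E) => [e|//|//]; rewrite !lee_fin => er e0.
rewrite -EFin_expe lee_fin lerXn2r //.
Qed.

Lemma hausdorff_eq0 A :
  (forall d e : R, (0 < d)%R -> (0 < e)%R -> @hausdorff_delta R n s d A <= e%:E) ->
  hausdorff s A = 0.
Proof.
move=> h; apply/eqP; rewrite eq_le hausdorff_ge0 andbT.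
apply: ge_ereal_sup => _ [d d0 <-]; apply/lee_addgt0Pr => e e0.
by rewrite add0e h.
Qed.

End hausdorff_covers.

Lemma nneseries_le_bound {R : realType} (u : nat -> \bar R) (M : \bar R) :
  (forall j, 0 <= u j)%E -> (forall m, \sum_(j < m) u j <= M)%E ->
  (\sum_(j <oo) u j <= M)%E.
Proof.
move=> u0 uM; apply: lime_le; first exact: is_cvg_nneseries.
by apply: nearW => m; rewrite big_mkord.
Qed.

(** * Dyadic cells *)

Section dyadic_cells.
Context {R : realType} (s : nat) (B : R).
Hypothesis B0 : 0 < B.
Local Notation D := {ffun 'I_s -> bool}.
Implicit Types (w v : seq D) (x b : 'I_s -> R).

(** Cells are addressed by words of binary digit vectors, the head of the word
being the finest digit: the parent of a cell is the tail of its word, and the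
empty word stands for the cube [-B, B]^s. *)
Definition cell_side w : R := 2 * B / 2 ^+ size w.

Fixpoint cell_corner w (j : 'I_s) : R :=
  if w is d :: w' then cell_corner w' j + (d j)%:R * cell_side w else - B.

Definition cell w : set ('I_s -> R) :=
  [set x | forall j, cell_corner w j <= x j <= cell_corner w j + cell_side w].

Lemma cell_side_gt0 w : 0 < cell_side w.
Proof. by rewrite divr_gt0 ?exprn_gt0 // mulr_gt0. Qed.

Lemma cell_side_cons d w : cell_side w = 2 * cell_side (d :: w).
Proof.
rewrite /cell_side /= exprS; have : (2 : R) ^+ size w != 0 by rewrite expf_neq0.
by move=> h; field.
Qed.

Lemma mem_cell_cons d w x : cell (d :: w) x <-> forall j,
  cell_corner w j + (d j)%:R * cell_side (d :: w) <= x j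
    <= cell_corner w j + (d j)%:R * cell_side (d :: w) + cell_side (d :: w).
Proof. by []. Qed.

Lemma cell_sub_parent d w : cell (d :: w) `<=` cell w.
Proof.
move=> x /mem_cell_cons xw j; move: (xw j) (cell_side_gt0 (d :: w)).
rewrite (cell_side_cons d w); move: (cell_side _) => l.
by case: (d j) => /= /andP[h1 h2] l0; apply/andP; split; lra.
Qed.

Lemma cell_child w x : cell w x -> exists d, cell (d :: w) x.
Proof.
move=> xw; pose d := [ffun j => cell_corner w j + cell_side w / 2 <= x j].
exists d; apply/mem_cell_cons => j; move: (xw j) (cell_side_gt0 (d :: w)).
rewrite ffunE (cell_side_cons d w); move: (cell_side _) => l.
by move=> /andP[h1 h2] l0; have [h|h] := leP (cell_corner w j + 2 * l / 2) (x j);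
  apply/andP; split => /=; lra.
Qed.

Lemma cell_of_size m x : cell [::] x -> exists2 w, size w = m & cell w x.
Proof.
move=> x0; elim: m => [|m [w wm /cell_child[d xd]]]; first by exists [::].
by exists (d :: w) => //=; rewrite wm.
Qed.

Lemma cell_nil x : (forall j, `|x j| <= B) -> cell [::] x.
Proof.
move=> xB j; have := xB j; rewrite ler_norml /= /cell_side /= expr0 divr1.
by move=> /andP[h1 h2]; apply/andP; split; lra.
Qed.

Section holes.
Variable A : set ('I_s -> R).

(** A cell that misses A, and a largest one among them: its parent meets A. *)
Definition empty_cell w := `[< forall x, A x -> ~ cell w x >].

Definition maximal_empty_cell w := empty_cell w && ~~ empty_cell (behead w).

Lemma empty_cell_cons d w : empty_cell w -> empty_cell (d :: w).
Proof. by move=> /asboolP h; apply/asboolP => x Ax /cell_sub_parent; exact: h. Qed.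

Lemma exists_maximal_empty_cell w x : ~~ empty_cell [::] -> empty_cell w -> cell w x ->
  exists v, [/\ maximal_empty_cell v, cell v x & cell_side w <= cell_side v].
Proof.
move=> n0; elim: w => [/(negP n0)//|d w ih] ew xw.
have [e|e] := boolP (empty_cell w).
  have [v [mv xv lv]] := ih e (cell_sub_parent _ _ _ xw).
  exists v; split => //; apply: le_trans lv; rewrite (cell_side_cons d w).
  by have := cell_side_gt0 (d :: w); lra.
by exists (d :: w); split => //; rewrite /maximal_empty_cell ew.
Qed.

Definition nonempty_count m := #|[set w : m.-tuple D | ~~ empty_cell w]%SET|.
Definition maximal_count m := #|[set w : m.-tuple D | maximal_empty_cell w]%SET|.

Lemma card_children m (P : pred (seq D)) :
  #|[set w : m.+1.-tuple D | P (behead w)]%SET| = (2 ^ s * #|[set w : m.-tuple D | P w]%SET|)%N.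
Proof.
have -> : (2 ^ s = #|[set: D]%SET|)%N by rewrite cardsT card_ffun card_bool card_ord.
rewrite -cardsX.
rewrite -(card_imset _ (f := fun dw : D * m.-tuple D => [tuple of dw.1 :: dw.2])); last first.
  by move=> [d w] [d' w'] /= /(congr1 val) /= [-> /val_inj ->].
apply: eq_card => w; rewrite inE; apply/idP/imsetP.
  case/tupleP: w => d w; rewrite /= => Pw; exists (d, w) => //.
  by rewrite !inE.
by move=> [[d w']]; rewrite !inE /= => Pw ->.
Qed.

(** The children of the cells that meet A either meet A or are maximal among
those missing it. *)
Lemma count_children m :
  (nonempty_count m.+1 + maximal_count m.+1 = 2 ^ s * nonempty_count m)%N.
Proof.
rewrite /nonempty_count /maximal_count -(card_children m (fun w => ~~ empty_cell w)) -cardsUI.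
rewrite [X in (_ + X)%N](_ : _ = 0%N) ?addn0; last first.
  by apply/eqP; rewrite cards_eq0; apply/eqP/setP => w; rewrite !inE /maximal_empty_cell;
    case: (empty_cell w).
apply: eq_card => w; rewrite !inE /maximal_empty_cell.
have [|] := boolP (empty_cell w) => //= ne; symmetry.
case/tupleP: w ne => d w /= ne.
by apply: contra ne; exact: empty_cell_cons.
Qed.

(** The share of the volume of the root cell occupied by the cells of
generation m that meet A. *)
Definition nonempty_ratio m : R := (nonempty_count m)%:R / (2 ^ s)%:R ^+ m.

(** The volume lost from one generation to the next is that of the maximal
empty cells: the total volume of the latter is a telescoping series. *)
Lemma maximal_ratio m : (maximal_count m.+1)%:R / (2 ^ s)%:R ^+ m.+1 =
  nonempty_ratio m - nonempty_ratio m.+1.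
Proof.
have b0 : (2 ^ s)%:R != 0 :> R by rewrite pnatr_eq0 expn_eq0.
have bm0 : (2 ^ s)%:R ^+ m != 0 :> R by rewrite expf_neq0.
have := congr1 (fun k => k%:R : R) (count_children m).
rewrite natrD natrM /nonempty_ratio exprS.
set u := (nonempty_count m.+1)%:R; set v := (nonempty_count m)%:R.
set c := (maximal_count _)%:R; set b := (2 ^ s)%:R => h.
have -> : c = b * v - u by rewrite -h; ring.
by field; apply/andP; split.
Qed.

Lemma maximal_ratio_tail (e : R) : 0 < e -> exists m0, forall m k, (m0 <= m)%N ->
  \sum_(j < k) (maximal_count (m + j).+1)%:R / (2 ^ s)%:R ^+ (m + j).+1 <= e.
Proof.
move=> e0.
have r0 m : 0 <= nonempty_ratio m by rewrite divr_ge0 ?exprn_ge0 // ler0n.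
have rS m : nonempty_ratio m.+1 <= nonempty_ratio m.
  by rewrite -subr_ge0 -maximal_ratio divr_ge0 ?exprn_ge0 // ler0n.
have rD m k : nonempty_ratio (m + k) <= nonempty_ratio m.
  elim: k => [|k ih]; first by rewrite addn0.
  by rewrite addnS (le_trans (rS _)).
have telescope m k : \sum_(j < k) (maximal_count (m + j).+1)%:R / (2 ^ s)%:R ^+ (m + j).+1 =
    nonempty_ratio m - nonempty_ratio (m + k).
  elim: k => [|k ih]; first by rewrite big_ord0 addn0 subrr.
  by rewrite big_ord_recr /= ih maximal_ratio addnS; ring.
have infr : has_inf (range nonempty_ratio).
  by split; [exists (nonempty_ratio 0), 0%N|exists 0 => _ [m _ <-]].
have [_ [m0 _ <-] hm0] := inf_adherent e0 infr.
exists m0 => m k m0m; rewrite telescope.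
have h1 : inf (range nonempty_ratio) <= nonempty_ratio (m + k).
  by apply: ge_inf; [case: infr|exists (m + k)%N].
have h2 : nonempty_ratio m <= nonempty_ratio m0 by rewrite -(subnKC m0m).
lra.
Qed.

(** There are only finitely many cells of generation at most m, and they are
closed. *)
Lemma cells_apart m x : exists2 e, 0 < e & forall w, (size w <= m)%N -> ~ cell w x ->
  forall b, cell w b -> exists j, e <= `|b j - x j|.
Proof.
have one w : exists2 e, 0 < e & ~ cell w x ->
    forall b, cell w b -> exists j, e <= `|b j - x j|.
  have [wx|nwx] := pselect (cell w x); first by exists 1.
  have /existsNP[j /negP] := nwx; rewrite negb_and -!ltNge => /orP[h|h].
    exists (cell_corner w j - x j) => [|_ b /(_ j)/andP[bj _]]; first by rewrite subr_gt0.
    by exists j; apply: le_trans (ler_norm _); lra.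
  exists (x j - (cell_corner w j + cell_side w)) => [|_ b /(_ j)/andP[_ bj]].
    by rewrite subr_gt0.
  by exists j; rewrite distrC; apply: le_trans (ler_norm _); lra.
have [f f0 fP] : exists2 f : seq D -> R, (forall w, 0 < f w) & forall w, ~ cell w x ->
    forall b, cell w b -> exists j, f w <= `|b j - x j|.
  have /choice[f fP] : forall w, exists e, 0 < e /\ (~ cell w x ->
      forall b, cell w b -> exists j, e <= `|b j - x j|).
    by move=> w; have [e e0 h] := one w; exists e.
  by exists f => w; case: (fP w).
exists (\big[Order.min/1]_(mw : {i : 'I_m.+1 & i.-tuple D}) f (tagged mw)).
  by elim/big_ind : _ => // u v u0 v0; rewrite lt_min u0.
move=> w wm nwx b wb; have [j h] := fP w nwx b wb; exists j; apply: le_trans h.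
rewrite -ltnS in wm.
pose t : {i : 'I_m.+1 & i.-tuple D} :=
  Tagged (fun i : 'I_m.+1 => i.-tuple D) (in_tuple w : (Ordinal wm).-tuple D).
apply: (bigmin_le _ t).
Qed.

End holes.
End dyadic_cells.

(** * Porous sets are null *)

Lemma outer_measure_finite_union {R : realType} {T : Type}
    (mu : {outer_measure set T -> \bar R}) (I : finType) (P : pred I) (F : I -> set T) :
  (mu (\big[setU/set0]_(i | P i) F i) <= \sum_(i | P i) mu (F i))%E.
Proof.
elim/big_rec2 : _ => [|i a X _ h]; first by rewrite outer_measure0.
by apply: le_trans (outer_measureU2 mu _ _) _; rewrite leeD2l.
Qed.

Lemma halving_archimedean {R : realType} (C e : R) : 0 < e ->
  exists m, forall k, (m <= k)%N -> C / 2 ^+ k <= e.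
Proof.
move=> e0; exists (Num.bound `|C / e|) => k mk.
have C_le : C / e <= k%:R.
  apply: le_trans (ler_norm _) (le_trans (ltW (archi_boundP (normr_ge0 _))) _).
  by rewrite ler_nat.
have k2 : k%:R <= (2 : R) ^+ k by rewrite -natrX ler_nat ltnW // ltn_expl.
rewrite ler_pdivrMr ?exprn_gt0 // mulrC -ler_pdivrMr //.
exact: le_trans C_le k2.
Qed.

(** The functions p_j are coordinates on A with Lipschitz inverse, in which A is
porous: next to each of its points, at arbitrarily small scales r, there is a
cube of side comparable to r that misses A. *)
Section porous_sets.
Context {R : realType} {n : nat} (s : nat).
Variables (A : set 'rV[R]_n) (p : 'I_s -> 'rV[R]_n -> R) (B L e : R).
Hypotheses (B0 : 0 < B) (L0 : 0 < L) (e0 : 0 < e).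
Hypothesis p_bounded : forall x j, A x -> `|p j x| + 1 <= B.
Hypothesis p_expanding : forall x y (r : R), A x -> A y -> 0 <= r ->
  (forall j, `|p j x - p j y| <= r) -> enorm (x - y) <= L * r.
Hypothesis p_porous : forall x, A x -> forall d : R, 0 < d ->
  exists b (r : R), [/\ 0 < r, r < d, forall j : 'I_s, `|b j - p j x| <= r &
    forall y, A y -> exists j, e * r < `|b j - p j y|].

Let pA : set ('I_s -> R) := [set (fun j => p j x) | x in A].
Let side := @cell_side R s B.
Let corner := @cell_corner R s B.
(** A hole of size e r contains a dyadic cell of side more than e r / 2, so its
distance r to the set is at most K times the side of that cell. *)
Let K : R := 2 / e.
Let K0 : 0 < K. Proof. by rewrite divr_gt0. Qed.

Let enlarged (w : seq {ffun 'I_s -> bool}) : set 'rV[R]_n := A `&`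
  [set x | forall j, corner w j - K * side w <= p j x <= corner w j + (1 + K) * side w].

Let enlarged_ediam w : (ediam (enlarged w) <= (L * ((2 * K + 1) * side w))%:E)%E.
Proof.
have := cell_side_gt0 s B B0 w; rewrite -/side => sw.
apply: ediam_le => x y [Ax xw] [Ay yw]; apply: p_expanding => //.
  by rewrite mulr_ge0 ?(ltW sw) //; have := K0; lra.
move=> j; move: (xw j) (yw j) => /andP[h1 h2] /andP[h3 h4].
by rewrite ler_norml; apply/andP; split; lra.
Qed.

Let enlarged_gauge w : (hausdorff_gauge s (enlarged w) <=
  (gauge_cst (R := R) s * (L * (2 * K + 1) * (2 * B)) ^+ s / (2 ^ s)%:R ^+ size w)%:E)%E.
Proof.
have := cell_side_gt0 s B B0 w; rewrite -/side => sw.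
have -> : gauge_cst s * (L * (2 * K + 1) * (2 * B)) ^+ s / (2 ^ s)%:R ^+ size w =
    gauge_cst (R := R) s * (L * ((2 * K + 1) * side w)) ^+ s.
  rewrite /side /cell_side natrX -exprM mulnC exprM -mulrA -expr_div_n.
  by congr (_ * _ ^+ _); ring.
apply: hausdorff_gauge_le (enlarged_ediam w).
by rewrite mulr_ge0 ?(ltW L0) // mulr_ge0 ?(ltW sw) //; have := K0; lra.
Qed.

(** The maximal empty cell around a hole near x is at least as large as the hole,
so its enlargement reaches x; it is of late generation because x keeps away from
the empty cells of early generations. *)
Let porous_cover m x : A x ->
  exists v, [/\ maximal_empty_cell s B pA v, (m < size v)%N & enlarged v x].
Proof.
move=> Ax; pose px j := p j x.
have [d0 d00 hd0] := cells_apart s B m px.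
have [|b [r [r0 rd bx bA]]] := p_porous x Ax (Num.min d0 1).
  by rewrite lt_min d00 ltr01.
move: rd; rewrite lt_min => /andP[rd0 r1].
have bnil : cell s B [::] b.
  apply: cell_nil => j; have h1 := bx j; have h2 := p_bounded x j Ax.
  have -> : b j = (b j - p j x) + p j x by rewrite subrK.
  by apply: le_trans (ler_normD _ _) _; lra.
have pxnil : cell s B [::] px.
  by apply: cell_nil => j; have := p_bounded x j Ax; rewrite /px; lra.
have ne : ~~ empty_cell s B pA [::].
  by apply/negP => /asboolP /(_ px) h; apply: h => //; exists x.
have er0 : 0 < e * r by rewrite mulr_gt0.
(* k is the coarsest generation whose cells fit into the hole around b *)
have exk : exists k, 2 * B / 2 ^+ k <= e * r.
  by have [k hk] := halving_archimedean (2 * B) (e * r) er0; exists k; exact: hk.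
case: (ex_minnP exk) => k hk kmin.
have [w wk bw] := cell_of_size s B B0 k b bnil.
have ew : empty_cell s B pA w.
  apply/asboolP => _ [a Aa <-] aw; have [j] := bA a Aa; rewrite ltNge => /negP; apply.
  apply: le_trans hk; move: (aw j) (bw j); rewrite /cell_side wk.
  by move=> /andP[h1 h2] /andP[h3 h4]; rewrite ler_norml; apply/andP; split; lra.
have [v [mv bv wv]] := exists_maximal_empty_cell s B B0 pA w b ne ew bw.
have rside : r <= K * side v.
  have her : e * r < 2 * side w.
    have k0 : (0 < k)%N.
      by rewrite -wk lt0n; apply: contra ne => /nilP <-.
    rewrite /side /cell_side wk; case: k k0 kmin {hk bw ew wv wk} => // k _ kmin.
    rewrite ltNge; apply/negP => h; have : (k < k)%N.
      apply: kmin; apply: le_trans h.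
      have k2 : (2 : R) ^+ k != 0 by rewrite expf_neq0.
      by rewrite exprS le_eqVlt; apply/orP; left; apply/eqP; field.
    by rewrite ltnn.
  rewrite /K mulrAC ler_pdivlMr // mulrC; apply: le_trans (ltW her) _.
  by rewrite ler_wpM2l.
exists v; split => //.
  rewrite ltnNge; apply/negP => vm.
  have npv : ~ cell s B v px.
    by move: mv => /andP[/asboolP ev _]; apply: ev; exists x.
  have [j] := hd0 v vm npv b bv; have := bx j; rewrite /px; lra.
split=> // j /=; have : corner v j <= b j <= corner v j + side v by exact: bv.
have := bx j; rewrite ler_norml mulrDl mul1r => /andP[h1 h2] /andP[h3 h4].
by apply/andP; split; lra.
Qed.

(** The gauges of the covering by enlarged cells of generation larger than m add
up to a constant times a tail of a convergent series. *)
Lemma porous_hausdorff_eq0 : hausdorff s A = 0%E.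
Proof.
apply: hausdorff_eq0 => d t d0 t0.
pose c := gauge_cst (R := R) s * (L * (2 * K + 1) * (2 * B)) ^+ s.
have c0 : 0 <= c.
  rewrite mulr_ge0 ?gauge_cst_ge0 ?exprn_ge0 // !mulr_ge0 ?(ltW L0) ?(ltW B0) //.
  by have := K0; lra.
have c1 : 0 < c + 1 by lra.
have [m0 hm0] := maximal_ratio_tail s B B0 pA (t / (c + 1)) (divr_gt0 t0 c1).
have [m1 hm1] : exists m1, forall m, (m1 <= m)%N -> L * ((2 * K + 1) * (2 * B / 2 ^+ m)) <= d.
  have [m1 hm1] := halving_archimedean (L * ((2 * K + 1) * (2 * B))) d d0.
  by exists m1 => m /hm1; rewrite !mulrA.
pose m := maxn m0 m1.
pose F j := \big[setU/set0]_(w : (m + j).+1.-tuple {ffun 'I_s -> bool} |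
   maximal_empty_cell s B pA w) enlarged w.
have AF : A `<=` \bigcup_j F j.
  move=> x Ax; have [v [mv vm xv]] := porous_cover m x Ax.
  have sv : size v == (m + (size v - m.+1)).+1.
    by apply/eqP; lia.
  exists (size v - m.+1)%N => //; rewrite /F.
  by rewrite (bigD1 (Tuple sv)) //=; left.
apply: (le_trans (@le_hausdorff_delta R n s d _ _ AF)).
apply: (le_trans (@hausdorff_delta_sigma_subadditive R n s d F)).
apply: nneseries_le_bound => [j|k]; first exact: hausdorff_delta_ge0.
have Fj j : (@hausdorff_delta R n s d (F j) <=
    (c * ((maximal_count s B pA (m + j).+1)%:R / (2 ^ s)%:R ^+ (m + j).+1))%:E)%E.
  apply: le_trans (outer_measure_finite_union _ _ _ _) _.
  apply: (@le_trans _ _ (\sum_(w : (m + j).+1.-tuple {ffun 'I_s -> bool} |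
      maximal_empty_cell s B pA w) (c / (2 ^ s)%:R ^+ (m + j).+1)%:E)%E).
    apply: lee_sum => w _; apply: (le_trans (hausdorff_delta_le_gauge _ _ _ _)).
      apply: le_trans (enlarged_ediam _) _; rewrite lee_fin /side /cell_side size_tuple.
      by apply: hm1; rewrite /m; lia.
    by have := enlarged_gauge w; rewrite size_tuple.
  rewrite sumEFin lee_fin sumr_const mulrCA mulr_natl /maximal_count.
  rewrite le_eqVlt; apply/orP; left; apply/eqP; congr (_ *+ _).
  by apply: eq_card => w; rewrite !inE.
apply: (@le_trans _ _ (\sum_(j < k)
    (c * ((maximal_count s B pA (m + j).+1)%:R / (2 ^ s)%:R ^+ (m + j).+1))%:E)%E).
  by apply: lee_sum => j _; exact: Fj.
rewrite sumEFin lee_fin -mulr_sumr.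
apply: (@le_trans _ _ (c * (t / (c + 1)))); first by rewrite ler_wpM2l // hm0 // leq_maxl.
by rewrite mulrCA ler_piMr ?(ltW t0) // ler_pdivrMr // mul1r; lra.
Qed.

End porous_sets.

(** * Contact sets are tangentially dense almost everywhere *)

Section tangent_points.
Context {R : realType} {n : nat}.
Implicit Types (C : set 'rV[R]_n) (nu : 'rV[R]_n -> 'rV[R]_n).

(** The set C approximates x + h within o(|h|) for h orthogonal to nu x. *)
Definition tangentially_dense C nu (x : 'rV[R]_n) := forall e : R, 0 < e ->
  exists2 d : R, 0 < d & forall h, dot h (nu x) = 0 -> enorm h < d ->
    exists2 c, C c & enorm (c - (x + h)) <= e * enorm h.

Lemma mem_tangent_ball (x u h : 'rV[R]_n) (r t : R) : 0 < r -> enorm u = 1 ->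
  dot h u = 0 -> enorm h ^+ 2 <= 2 * r * t - t ^+ 2 -> eball (x - r *: u) r (x + h - t *: u).
Proof.
move=> r0 u1 hu ht; rewrite /eball /= enorm_le ?(ltW r0) //.
have -> : x + h - t *: u - (x - r *: u) = h + (r - t) *: u.
  by apply/rowP => k; rewrite !mxE; ring.
have uu : dot u u = 1 by rewrite -enorm_sq u1 expr1n.
rewrite !dot_linear uu (dotC u h) hu -enorm_sq; nra.
Qed.

End tangent_points.

Section projection.
Context {R : realType} {s : nat}.
Implicit Types (w u v : 'rV[R]_s.+1) (i : 'I_s.+1).
Local Notation n := (s.+1%:R : R).

Lemma dot_lift i w v : dot w v =
  w ord0 i * v ord0 i + \sum_j w ord0 (lift i j) * v ord0 (lift i j).
Proof. by rewrite dotE (bigD1_ord i). Qed.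

Lemma enorm_le_lift i w (a r : R) : `|w ord0 i| <= a ->
  (forall j, `|w ord0 (lift i j)| <= r) -> enorm w <= a + s%:R * r.
Proof.
move=> wa wr; apply: le_trans (enorm_le_sum _) _; rewrite (bigD1_ord i) //= lerD //.
apply: le_trans (ler_sum _ (fun j _ => wr j)) _.
by rewrite sumr_const card_ord mulr_natl.
Qed.

Lemma exists_large_coord u : enorm u = 1 -> exists i (b : bool), n^-1 <= (-1) ^+ b * u ord0 i.
Proof.
move=> u1; have [i ui] : exists i, n^-1 <= `|u ord0 i|.
  apply: contrapT => /forallNP h; have : enorm u < 1.
    apply: le_lt_trans (enorm_le_sum _) _.
    have -> : 1 = \sum_(i < s.+1) n^-1.
      by rewrite sumr_const card_ord -[RHS]mulr_natr mulVf // pnatr_eq0.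
    rewrite !big_ord_recl ltr_leD //; last first.
      by apply: ler_sum => i _; rewrite ltW // ltNge; apply/negP/h.
    by rewrite ltNge; apply/negP/h.
  by rewrite u1 ltxx.
exists i, (u ord0 i < 0); apply: le_trans ui _.
by case: ltP => h; rewrite ?expr0 ?expr1 ?mul1r ?mulN1r ?(ltr0_norm h) ?(ger0_norm h).
Qed.

(** If w is almost below the hyperplane orthogonal to u, then the coordinate
along which u is large is controlled by the other ones. *)
Lemma coord_le_of_dot_le i w u (a r t : R) : `|a| = 1 -> enorm u = 1 ->
  n^-1 <= a * u ord0 i -> 0 <= r -> 0 <= t ->
  (forall j, `|w ord0 (lift i j)| <= r) -> dot w u <= t ->
  a * w ord0 i <= n * (s%:R * r + t).
Proof.
move=> a1 u1 ui r0 t0 wr; rewrite (dot_lift i) => wu.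
have aa : a * a = 1 by rewrite -expr2 -real_normK ?num_real // a1 expr1n.
have n0 : 0 < n by [].
have srt : 0 <= s%:R * r + t by rewrite addr_ge0 // mulr_ge0.
have [aw|aw] := leP (a * w ord0 i) 0.
  by rewrite (le_trans aw) // mulr_ge0 // ltW.
have sum_ge : - (s%:R * r) <= \sum_j w ord0 (lift i j) * u ord0 (lift i j).
  have -> : - (s%:R * r) = \sum_(j < s) - r by rewrite sumr_const card_ord -mulr_natl; ring.
  apply: ler_sum => j _; have := ler_norm (- (w ord0 (lift i j) * u ord0 (lift i j))).
  rewrite normrN normrM => h.
  have := wr j; have := coord_le_enorm u (lift i j); rewrite u1 => h1 h2.
  have : `|w ord0 (lift i j)| * `|u ord0 (lift i j)| <= r * 1 by rewrite ler_pM.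
  lra.
have h : (a * w ord0 i) * (a * u ord0 i) <= s%:R * r + t.
  have -> : (a * w ord0 i) * (a * u ord0 i) = (a * a) * (w ord0 i * u ord0 i) by ring.
  rewrite aa mul1r; lra.
rewrite [leRHS]mulrC -ler_pdivrMr //; apply: le_trans h.
by rewrite ler_wpM2l // ltW.
Qed.

End projection.

(** Each point of C is touched by a ball of radius r which lies below the tangent
hyperplane at every other point of C.  The set is cut into pieces on which one
signed coordinate of the normal is at least 1/n; on each piece the other
coordinates are a bi-Lipschitz chart. *)
Section contact_set.
Context {R : realType} {s : nat}.
Variables (C : set 'rV[R]_s.+1) (nu : 'rV[R]_s.+1 -> 'rV[R]_s.+1) (r M : R).
Hypotheses (r0 : 0 < r) (M0 : 0 <= M).
Hypothesis C_bounded : forall c, C c -> enorm c <= M.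
Hypothesis nu_unit : forall c, C c -> enorm (nu c) = 1.
Hypothesis ball_below : forall c c' y, C c -> C c' ->
  eball (c' - r *: nu c') r y -> dot (y - c) (nu c) <= 0.
Local Notation n := (s.+1%:R : R).

Let contact_le c c' : C c -> C c' -> dot (c' - c) (nu c) <= 0.
Proof.
move=> Cc Cc'; apply: (ball_below c c' _ Cc Cc'); have u1 := nu_unit _ Cc'.
rewrite /eball /= opprB addrC subrK.
by rewrite enormZ u1 mulr1 ger0_norm // ltW.
Qed.

Let hole (e : R) (x : 'rV[R]_s.+1) := forall d : R, 0 < d ->
  exists h, [/\ dot h (nu x) = 0, 0 < enorm h, enorm h < d &
    forall c, C c -> e * enorm h < enorm (c - (x + h))].

Let piece (e : R) i (b : bool) : set 'rV[R]_s.+1 :=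
  [set x | [/\ C x, n^-1 <= (-1) ^+ b * nu x ord0 i & hole e x]].

(** A tangent vector h far from C gives a hole of the chart around the projection
of x + h.  Indeed let y be a point of the piece, and w = y - (x + h), whose
projection is small: w is not far above by the hyperplane at x, and not far below
by the hyperplane at y, which leaves out the ball at x. *)
Let piece_null (e : R) i b : 0 < e -> hausdorff s (piece e i b) = 0%E.
Proof.
move=> e0; set a : R := (-1) ^+ b.
have a1 : `|a| = 1 by rewrite normrX normrN1 expr1n.
have abs_a (t : R) : `|t| = `|a * t| by rewrite normrM a1 mul1r.
have n0 : 0 < n by [].
have s0 : 0 <= s%:R :> R by [].
(* With e' = e / (2 L), one half of the budget e |h| pays for the projection of w,
   the other one for the curvature of the ball at x. *)
pose L : R := (n + 1) * s%:R + 1.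
have L0 : 0 < L by rewrite ltr_pwDr // mulr_ge0 // addr_ge0 // ltW.
pose e' := e / (2 * L).
have e'0 : 0 < e' by rewrite divr_gt0 // mulr_gt0.
apply: (@porous_hausdorff_eq0 R s.+1 s _ (fun j x => x ord0 (lift i j)) (M + 1) L e').
- by rewrite ltr_pwDr.
- by [].
- by [].
- by move=> x j [Cx _ _]; rewrite lerD2r (le_trans (coord_le_enorm _ _)) // C_bounded.
- move=> x y t [Cx xi _] [Cy yi _] t0 xy.
  have xy' j : `|(x - y) ord0 (lift i j)| <= t by rewrite !mxE.
  have yx' j : `|(y - x) ord0 (lift i j)| <= t by rewrite !mxE distrC.
  have h1 := coord_le_of_dot_le i (y - x) (nu x) a t 0 a1 (nu_unit _ Cx) xi t0 (lexx 0)
    yx' (contact_le _ _ Cx Cy).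
  have h2 := coord_le_of_dot_le i (x - y) (nu y) a t 0 a1 (nu_unit _ Cy) yi t0 (lexx 0)
    xy' (contact_le _ _ Cy Cx).
  have h3 : `|(x - y) ord0 i| <= n * (s%:R * t).
    rewrite abs_a ler_norml; move: h1 h2; rewrite !mxE !addr0 => h1 h2.
    by apply/andP; split; [move: h1|]; rewrite ?mulrBr; lra.
  apply: le_trans (enorm_le_lift i _ _ _ h3 xy') _.
  by rewrite /L; nra.
move=> x [Cx xi hx] d d0.
have u1 := nu_unit _ Cx.
pose d' := Num.min d (Num.min r (r * e / (2 * n))).
have d'0 : 0 < d' by rewrite !lt_min d0 r0 /= divr_gt0 ?mulr_gt0.
have [h [hu h0 hd' hC]] := hx d' d'0.
move: hd'; rewrite !lt_min => /and3P[hd hr he].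
exists (fun j => (x + h) ord0 (lift i j)), (enorm h); split => //.
  by move=> j; rewrite !mxE addrAC subrr add0r coord_le_enorm.
move=> y [Cy yi _]; apply: contrapT => /forallNP nj.
set w := y - (x + h).
have wj j : `|w ord0 (lift i j)| <= e' * enorm h.
  by rewrite /w !mxE distrC leNgt; apply/negP; have := nj j; rewrite !mxE.
have eh0 : 0 <= e' * enorm h by rewrite mulr_ge0 ?enorm_ge0 // ltW.
have wx : dot w (nu x) <= 0.
  by rewrite /w opprD addrA dotBl hu subr0; exact: contact_le.
pose t := enorm h ^+ 2 / r.
have t0 : 0 <= t by rewrite divr_ge0 ?exprn_ge0 ?enorm_ge0 // ltW.
have wy : dot (- w) (nu y) <= t.
  have : dot (x + h - t *: nu x - y) (nu y) <= 0.
    apply: (ball_below y x _ Cy Cx); apply: mem_tangent_ball => //.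
    have tr : t * r = enorm h ^+ 2 by rewrite /t divfK // gt_eqF.
    have : t <= r.
      by rewrite /t ler_pdivrMr // -expr2 ler_pXn2r ?nnegrE ?enorm_ge0 ?(ltW r0) ?(ltW hr).
    by move=> tler; nra.
  have -> : x + h - t *: nu x - y = - w - t *: nu x.
    by rewrite /w; apply/rowP => k; rewrite !mxE; ring.
  rewrite dotBl dotZl subr_le0 => /le_trans; apply.
  apply: ler_piMr => //; apply: le_trans (dot_le _ _) _.
  by rewrite u1 nu_unit // mulr1.
have wj' j : `|(- w) ord0 (lift i j)| <= e' * enorm h by rewrite mxE normrN.
have h1 := coord_le_of_dot_le i w (nu x) a _ 0 a1 u1 xi eh0 (lexx 0) wj wx.
have h2 := coord_le_of_dot_le i (- w) (nu y) a _ t a1 (nu_unit _ Cy) yi eh0 t0 wj' wy.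
have h3 : `|w ord0 i| <= n * (s%:R * (e' * enorm h) + t).
  rewrite abs_a ler_norml; move: h2; rewrite mxE mulrN => h2.
  by apply/andP; split; [lra|apply: le_trans h1 _; rewrite ler_wpM2l ?lerD // ltW].
have := hC y Cy; rewrite -/w ltNge => /negP; apply.
apply: le_trans (enorm_le_lift i _ _ _ h3 wj) _.
have nt : n * t <= e / 2 * enorm h.
  have -> : n * t = enorm h * (n * enorm h / r) by rewrite /t; field; rewrite gt_eqF.
  rewrite mulrC ler_wpM2r ?enorm_ge0 //.
  move: he; rewrite ltr_pdivlMr ?mulr_gt0 // => he.
  by rewrite ler_pdivrMr // ; lra.
have eL : e' * L = e / 2 by rewrite /e'; field; rewrite gt_eqF.
have -> : e * enorm h = (e' * L + e / 2) * enorm h by rewrite eL; field.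
by rewrite /L; nra.
Qed.

Lemma not_tangentially_dense_null :
  hausdorff s [set x | C x /\ ~ tangentially_dense C nu x] = 0%E.
Proof.
pose e (m : nat) : R := m.+1%:R^-1.
pose N m := \big[setU/set0]_(ib : 'I_s.+1 * bool) piece (e m) ib.1 ib.2.
apply/eqP; rewrite eq_le hausdorff_ge0 andbT.
apply: (@le_trans _ _ (hausdorff s (\bigcup_m N m))).
  apply: le_hausdorff => x [Cx /existsNP[e1 /not_implyP[e10 nd]]].
  have [m me] : exists m, e m <= e1.
    exists (Num.bound e1^-1); rewrite /e invf_ple ?posrE //.
    apply: le_trans (ltW (archi_boundP _)) _; first by rewrite invr_ge0 ltW.
    by rewrite ler_nat.
  exists m => //; have [i [b ib]] := exists_large_coord _ (nu_unit _ Cx).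
  rewrite /N (bigD1 (i, b)) //=; left; split => // d d0.
  move/forall2NP : nd => /(_ d)[//|/existsNP[h /not_implyP[hu /not_implyP[hd hC]]]].
  have {}hC c : C c -> e1 * enorm h < enorm (c - (x + h)).
    by move=> Cc; rewrite ltNge; apply/negP => h1; apply: hC; exists c.
  exists h; split => //.
    rewrite lt_neqAle enorm_ge0 andbT eq_sym; apply/eqP => h0.
    have := hC x Cx; rewrite h0 mulr0 opprD addrA subrr sub0r enormN h0.
    by rewrite ltxx.
  move=> c Cc; apply: le_lt_trans (hC c Cc).
  by rewrite ler_wpM2r ?enorm_ge0.
apply: (le_trans (@hausdorff_sigma_subadditive R s.+1 s N)).
rewrite eseries0 // => m _ _; apply/eqP; rewrite eq_le hausdorff_ge0 andbT.
apply: le_trans (outer_measure_finite_union (@hausdorff R s.+1 s) _ _ _) _.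
by rewrite big1 // => -[i b] _; apply: piece_null; rewrite invr_gt0.
Qed.

End contact_set.

(** * Closed sets are measurable for the Hausdorff measure *)

Lemma ereal_sup_add_le {R : realType} (A B : set (\bar R)) (M : \bar R) :
  (forall a, A a -> 0 <= a)%E -> (exists a, A a) -> (exists b, B b) ->
  (forall b, B b -> 0 <= b)%E ->
  (forall a b, A a -> B b -> a + b <= M)%E -> (ereal_sup A + ereal_sup B <= M)%E.
Proof.
move=> A0 [a0 Aa0] [b0 Bb0] B0 AB.
have M0 : (0 <= M)%E.
  apply: (@le_trans _ _ (a0 + b0)%E); last exact: AB.
  by apply: adde_ge0; [exact: A0|exact: B0].
case: M M0 AB => [m||//] M0 AB; last by rewrite leey.
have finB b : B b -> b \is a fin_num.
  move=> Bb; rewrite ge0_fin_numE ?B0 //; apply: le_lt_trans (ltry m).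
  by rewrite (le_trans _ (AB _ _ Aa0 Bb)) // leeDr ?A0.
have supA0 : (0 <= ereal_sup A)%E by rewrite (le_trans (A0 _ Aa0)) //; exact: ereal_sup_ubound.
have h b : B b -> (ereal_sup A + b <= m%:E)%E.
  move=> Bb; rewrite -leeBrDr ?finB //; apply: ge_ereal_sup => a Aa.
  by rewrite leeBrDr ?finB // AB.
have finA : ereal_sup A \is a fin_num.
  rewrite ge0_fin_numE //; apply: le_lt_trans (ltry m).
  by rewrite (le_trans _ (h _ Bb0)) // leeDl ?B0.
rewrite addeC -leeBrDr //; apply: ge_ereal_sup => b Bb.
by rewrite leeBrDr // addeC h.
Qed.

Section metric_outer_measure.
Context {R : realType} {n s : nat}.
Implicit Types (X Y F : set 'rV[R]_n).
Local Open Scope ereal_scope.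
Local Notation Hd := (@hausdorff_delta R n s).
Local Notation H := (@hausdorff R n s).

Lemma hausdorff_delta_anti (d d' : R) X : (d' <= d)%R -> Hd d X <= Hd d' X.
Proof.
move=> dd; apply: ereal_inf_le_tmp => _ [E [XE dE] <-]; exists E => //.
by split=> // k; rewrite (le_trans (dE k)) // lee_fin.
Qed.

(** No set of diameter at most d meets both X and Y, so a cover of the union
splits into a cover of X and a cover of Y. *)
Lemma hausdorff_delta_apart (d : R) X Y :
  (forall x y, X x -> Y y -> d < enorm (x - y))%R -> Hd d X + Hd d Y <= Hd d (X `|` Y).
Proof.
move=> apart; apply: le_ereal_inf_tmp => _ [E [XYE dE] <-].
pose sub Z k : set 'rV[R]_n := if `[< E k `&` Z !=set0 >] then E k else set0.
have subd Z k : ediam (sub Z k) <= d%:E.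
  by rewrite /sub; case: asboolP => // _; rewrite ediam0 leNye.
have subZ Z : Z `<=` X `|` Y -> Hd d Z <= \sum_(k <oo) hausdorff_gauge s (sub Z k).
  move=> ZXY; apply: ereal_inf_lbound; exists (sub Z) => //; split => // z Zz.
  have [k _ Ekz] := XYE z (ZXY z Zz); exists k => //.
  by rewrite /sub; case: asboolP => // h; exfalso; apply: h; exists z.
apply: (le_trans (leeD (subZ X (@subsetUl _ _ _)) (subZ Y (@subsetUr _ _ _)))).
rewrite -nneseriesD; [|by move=> *; exact: hausdorff_gauge_ge0..].
apply: lee_nneseries => [k _ _|k _]; first by rewrite adde_ge0 ?hausdorff_gauge_ge0.
rewrite /sub; case: asboolP => [[x [Ex Xx]]|_]; case: asboolP => [[y [Ey Yy]]|_];
  rewrite ?hausdorff_gauge0 ?adde0 ?add0e ?hausdorff_gauge_ge0 //.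
have := apart x y Xx Yy; rewrite ltNge => /negP; case.
by rewrite -lee_fin (le_trans _ (dE k)) //; apply: ereal_sup_ubound; exists (x, y).
Qed.

Lemma hausdorff_apart (e : R) X Y : (0 < e)%R ->
  (forall x y, X x -> Y y -> e <= enorm (x - y))%R -> H X + H Y <= H (X `|` Y).
Proof.
move=> e0 apart; apply: ereal_sup_add_le.
- by move=> _ [d _ <-]; exact: hausdorff_delta_ge0.
- by exists (Hd 1 X); exists 1%R => //=; exact: ltr01.
- by exists (Hd 1 Y); exists 1%R => //=; exact: ltr01.
- by move=> _ [d _ <-]; exact: hausdorff_delta_ge0.
move=> _ _ [d d0 <-] [d' d'0 <-] /=.
pose m : R := Num.min (Num.min d d') (e / 2)%R.
have m0 : (0 < m)%R by rewrite !lt_min d0 d'0 divr_gt0.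
have [md [md' me]] : [/\ m <= d, m <= d' & m <= e / 2]%R.
  by split; rewrite /m !ge_min lexx ?orbT.
apply: (@le_trans _ _ (Hd m X + Hd m Y)).
  by rewrite leeD // hausdorff_delta_anti.
apply: (@le_trans _ _ (Hd m (X `|` Y))).
  by apply: hausdorff_delta_apart => x y Xx Yy; have := apart x y Xx Yy; lra.
by apply: ereal_sup_ubound; exists m.
Qed.

(** Caratheodory's criterion.  The part of X outside F is exhausted by the sets
Z k of points at distance at least 1/(k+1) from F; these are apart from F, and the
shells between them are apart from each other when not consecutive, so the shells
have finite total measure and the error of replacing X \ F by Z k tends to 0. *)
Lemma closed_caratheodory F : closed F -> (hausdorff s).-caratheodory F.
Proof.
move=> cF; apply: le_caratheodory_measurable => X; change (H (X `&` F) + H (X `&` ~` F) <= H X).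
have [->|Xfin] := eqVneq (H X) +oo; first by rewrite leey.
have {}Xfin : H X < +oo by rewrite ltey.
pose c (k : nat) : R := (k.+1%:R^-1)%R.
have c0 k : (0 < c k)%R by rewrite invr_gt0.
have cS k : (c k.+1 < c k)%R by rewrite ltf_pV2 ?posrE // ltr_nat.
pose Z k := X `&` [set x | forall y, F y -> (c k <= enorm (x - y))%R].
pose S k := Z k.+1 `\` Z k.
have ZX k : Z k `<=` X by move=> x [].
have ZS k : Z k `<=` Z k.+1.
  by move=> x [Xx h]; split => // y Fy; apply: le_trans (ltW (cS k)) (h y Fy).
have Zmono k m : Z k `<=` Z (k + m)%N.
  elim: m => [|m ih]; first by rewrite addn0.
  by rewrite addnS; apply: subset_trans ih (ZS _).
have Zsep k : H (Z k) + H (S k.+1) <= H (Z k.+2).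
  apply: (@le_trans _ _ (H (Z k `|` S k.+1))); last first.
    apply: le_hausdorff => x [/ZS/ZS//|[]//].
  apply: (@hausdorff_apart (c k - c k.+1)%R); first by rewrite subr_gt0.
  move=> x z [Xx hx] [[Xz _] nz].
  have [y Fy zy] : exists2 y, F y & (enorm (z - y) < c k.+1)%R.
    apply: contrapT => h; apply: nz; split => // y Fy; rewrite leNgt.
    by apply/negP => zy; apply: h; exists y.
  have := hx y Fy; have := enormD (x - z)%R (z - y)%R; rewrite addrA subrK; lra.
have shells m : \sum_(j < m) H (S j.+1) <= H (Z m) + H (Z m.+1).
  elim: m => [|m ih]; first by rewrite big_ord0 adde_ge0 ?hausdorff_ge0.
  rewrite big_ord_recr /=; apply: le_trans (leeD2r _ ih) _.
  rewrite addeAC addeC; apply: leeD2l; exact: Zsep.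
have shells_fin : \sum_(0 <= j <oo) H (S j.+1) < +oo.
  apply: (@le_lt_trans _ _ (H X + H X)); last by rewrite lte_add_pinfty.
  apply: nneseries_le_bound => [j|m]; first exact: hausdorff_ge0.
  by apply: le_trans (shells m) _; apply: leeD; apply: le_hausdorff; exact: ZX.
have tail_cvg := nneseries_tail_cvg shells_fin (fun k _ => hausdorff_ge0 s (S k.+1)).
have bound k : H (X `&` F) + H (X `&` ~` F) <= H X + \sum_(k <= j <oo) H (S j.+1).
  have cover : X `&` ~` F `<=` Z k.+1 `|` \bigcup_(j in ~` `I_k) S j.+1.
    move=> x [Xx nFx].
    have [m Zm] : exists m, Z m x.
      have : ~ closure F x by rewrite -(proj1 (closure_id F) cF).
      move/closure_enormP => /existsNP[e /not_implyP[e0 he]].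
      have [m me] : exists m, (c m <= e)%R.
        exists (Num.bound e^-1%R); rewrite /c invf_ple ?posrE //.
        apply: le_trans (ltW (archi_boundP _)) _; first by rewrite invr_ge0 ltW.
        by rewrite ler_nat.
      exists m; split => // y Fy; apply: le_trans me _; rewrite enormB leNgt.
      by apply/negP => ye; apply: he; exists y.
    have exm : exists m, `[< Z m x >] by exists m; apply/asboolP.
    case: (ex_minnP exm) => {m Zm exm} m /asboolP Zm mmin.
    have [mk|km] := leqP m k.+1; first by left; rewrite -(subnKC mk); exact: Zmono.
    right; case: m km mmin Zm => [//|[//|j]] kj mmin Zm; exists j.
      by rewrite /= /setC /mkset /= ltnNge; apply/negP; rewrite negbK; lia.
    split => // Zj; have : (j.+2 <= j.+1)%N by apply: mmin; apply/asboolP.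
    by rewrite ltnn.
  apply: (@le_trans _ _ (H (X `&` F) + (H (Z k.+1) + \sum_(k <= j <oo) H (S j.+1)))).
    apply: leeD2l; apply: le_trans (le_hausdorff s cover) _.
    apply: le_trans (outer_measureU2 (@hausdorff R n s) _ _) _; apply: leeD2l.
    exact: (outer_measure_sigma_subadditive_tail (@hausdorff R n s) k (fun j => S j.+1)).
  rewrite addeA; apply: leeD2r.
  apply: (@le_trans _ _ (H (X `&` F `|` Z k.+1))).
    apply: (@hausdorff_apart (c k.+1)) => // x y [Xx Fx] [Xy hy].
    by rewrite enormB hy.
  by apply: le_hausdorff => x [[]//|/ZX].
apply/lee_addgt0Pr => e e0.
have /tail_cvg[k _ /(_ k (leqnn k)) /= /ltW tk] : nbhs (0 : \bar R) [set x | x < e%:E].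
  by apply: open_nbhs_nbhs; split; [exact: open_ereal_lt_ereal|rewrite /= lte_fin].
by apply: le_trans (bound k) _; apply: leeD2l.
Qed.

End metric_outer_measure.

(** * Integrals of arbitrary functions as suprema over simple functions *)

(** Also for the undetermined form +oo - +oo, which is -oo. *)
Lemma muleB_gt0 {R : realType} (c : R) (a b : \bar R) : 0 < c ->
  (c%:E * (a - b) = c%:E * a - c%:E * b)%E.
Proof.
move=> c0; case: a b => [a| |] [b| |];
  rewrite /= ?gt0_muley ?gt0_muleNy ?lte_fin //= -?EFinM -?EFinB ?gt0_muley ?gt0_muleNy ?lte_fin //.
by rewrite mulrBr.
Qed.

Section nnsfun_of_function.
Context d (T : measurableType d) (R : realType) (f : T -> R).
Hypotheses (mf : measurable_fun setT f) (finf : finite_set (range f)) (f0 : forall x, 0 <= f x).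
Import HBNNSimple.
HB.instance Definition _ := isMeasurableFun.Build _ _ T R f mf.
HB.instance Definition _ := FiniteImage.Build T R f finf.
HB.instance Definition _ := isNonNegFun.Build T R f f0.
Definition mk_nnsfun : {nnsfun T >-> R} := f.
End nnsfun_of_function.

Section lower_integral.
Context d (T : measurableType d) (R : realType) (mu : {measure set T -> \bar R}).
Implicit Types (F G : T -> \bar R) (A N : set T).
Local Open Scope ereal_scope.
Import HBNNSimple.

Definition lower_integral F := ereal_sup [set sintegral mu h |
  h in [set h : {nnsfun T >-> R} | forall x, (h x)%:E <= F x]].

Lemma integral_lower_integral (D : set T) (f : T -> \bar R) :
  integral mu D f = lower_integral ((f \_ D)^\+) - lower_integral ((f \_ D)^\-).
Proof. by []. Qed.

Lemma lower_integral_ge0 F : (forall x, 0 <= F x) -> 0 <= lower_integral F.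
Proof.
move=> F0; apply: ereal_sup_ubound; exists nnsfun0 => //; exact: sintegral0.
Qed.

(** Additivity holds for arbitrary F because simple functions can be cut along A
and glued back. *)
Lemma lower_integral_setID A F : measurable A -> (forall x, 0 <= F x) ->
  lower_integral F = lower_integral (F \_ A) + lower_integral (F \_ (~` A)).
Proof.
move=> mA F0; have mCA := measurableC mA; apply/eqP; rewrite eq_le; apply/andP; split.
  apply: ge_ereal_sup => _ [h /= hF <-].
  have projE B (mB : measurable B) x : proj_nnsfun h mB x = (h \_ B) x by rewrite mrestrict.
  have -> : sintegral mu h =
      sintegral mu (proj_nnsfun h mA) + sintegral mu (proj_nnsfun h mCA).
    rewrite -sintegralD; apply: eq_sintegral => x.
    rewrite -[RHS]/(proj_nnsfun h mA x + proj_nnsfun h mCA x)%R !projE /patch in_setC.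
    by case: (x \in A); rewrite /= ?addr0 ?add0r.
  by apply: leeD; apply: ereal_sup_ubound; eexists => //= x; rewrite projE /patch;
    case: ifP.
apply: ereal_sup_add_le.
- by move=> _ [h _ <-]; exact: sintegral_ge0.
- exists 0, nnsfun0; last exact: sintegral0.
  by move=> x /=; rewrite /patch; case: ifP.
- exists 0, nnsfun0; last exact: sintegral0.
  by move=> x /=; rewrite /patch; case: ifP.
- by move=> _ [h _ <-]; exact: sintegral_ge0.
move=> _ _ [h /= hA <-] [g /= gA <-]; rewrite -sintegralD.
apply: ereal_sup_ubound; exists (add_nnsfun h g) => // x /=.
rewrite EFinD; move: (hA x) (gA x); rewrite /patch in_setC.
have h0 : 0 <= (h x)%:E by rewrite lee_fin.
have g0 : 0 <= (g x)%:E by rewrite lee_fin.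
case: (x \in A) => /= hx gx.
  have -> : (g x)%:E = 0 by apply/eqP; rewrite eq_le gx.
  by rewrite adde0.
have -> : (h x)%:E = 0 by apply/eqP; rewrite eq_le hx.
by rewrite add0e.
Qed.

Lemma lower_integral_null N F : measurable N -> mu N = 0 -> (forall x, 0 <= F x) ->
  lower_integral (F \_ N) = 0.
Proof.
move=> mN N0 F0; apply/eqP; rewrite eq_le lower_integral_ge0 ?andbT; last first.
  by move=> x; rewrite /patch; case: ifP.
apply: ge_ereal_sup => _ [h /= hF <-]; rewrite sintegralET fsbig1 // => t _.
have [->|t0] := eqVneq t 0%R; first by rewrite mul0e.
rewrite (_ : mu _ = 0) ?mule0 //; apply: (subset_measure0 (B := N)) => //.
move=> x /= hxt; apply: contrapT => nNx; move: (hF x).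
rewrite /patch memNset // lee_fin => hx0; move/negP: t0; apply.
by rewrite -hxt eq_le hx0 /=.
Qed.

Lemma lower_integral_swap (F1 F2 G1 G2 : T -> \bar R) (S N : set T) :
  measurable S -> measurable N -> mu N = 0 ->
  (forall x, 0 <= F1 x) -> (forall x, 0 <= F2 x) ->
  (forall x, 0 <= G1 x) -> (forall x, 0 <= G2 x) ->
  (forall x, ~ N x -> S x -> F1 x = G1 x /\ F2 x = G2 x) ->
  (forall x, ~ N x -> ~ S x -> F1 x = G2 x /\ F2 x = G1 x) ->
  lower_integral F1 + lower_integral F2 = lower_integral G1 + lower_integral G2.
Proof.
move=> mS mN N0 F10 F20 G10 G20 eqS eqnS.
have patch_ge0 F A : (forall x, 0 <= F x) -> forall x, 0 <= (F \_ A) x.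
  by move=> F0 x; rewrite /patch; case: ifP.
have split F : (forall x, 0 <= F x) -> lower_integral F =
    lower_integral (F \_ (~` N) \_ S) + lower_integral (F \_ (~` N) \_ (~` S)).
  move=> F0; rewrite (lower_integral_setID N) // lower_integral_null // add0e.
  by rewrite (lower_integral_setID S) //; exact: patch_ge0.
have patch_eq F G A : (forall x, ~ N x -> A x -> F x = G x) ->
    (F \_ (~` N)) \_ A = (G \_ (~` N)) \_ A.
  move=> FG; apply/funext => x; rewrite /patch.
  by case: ifPn => // /set_mem Ax; case: ifPn => // /set_mem nNx; exact: FG.
rewrite (split F1) // (split F2) // (split G1) // (split G2) // addeACA [RHS]addeACA; congr (_ + _).
  by rewrite (patch_eq F1 G1) ?(patch_eq F2 G2) // => x nNx /(eqS x nNx)[].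
rewrite addeC; congr (_ + _); congr lower_integral; apply: patch_eq => x nNx /(eqnS x nNx)[];
  by [].
Qed.

(** Exchanging two integrands on a measurable set, and changing them on a null
set, preserves the sum of the integrals.  This includes infinite values: -oo
absorbs, and either side is -oo as soon as one negative part is infinite. *)
Lemma integral_swap (D1 D2 E1 E2 S N : set T) (f1 f2 g1 g2 : T -> \bar R) :
  measurable S -> measurable N -> mu N = 0 ->
  (forall x, ~ N x -> S x -> (f1 \_ D1) x = (g1 \_ E1) x /\ (f2 \_ D2) x = (g2 \_ E2) x) ->
  (forall x, ~ N x -> ~ S x -> (f1 \_ D1) x = (g2 \_ E2) x /\ (f2 \_ D2) x = (g1 \_ E1) x) ->
  integral mu D1 f1 + integral mu D2 f2 = integral mu E1 g1 + integral mu E2 g2.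
Proof.
move=> mS mN N0 eqS eqnS; rewrite !integral_lower_integral.
have regroup (a b c e : \bar R) : 0 <= b -> 0 <= e -> (a - b) + (c - e) = (a + c) - (b + e).
  by move=> b0 e0; rewrite addeACA oppeD // ge0_adde_def // inE.
rewrite !regroup ?lower_integral_ge0 //; congr (_ - _).
  by apply: (lower_integral_swap _ _ _ _ S N) => // x nNx Sx; rewrite !funeposE;
    [have [-> ->] := eqS x nNx Sx|have [-> ->] := eqnS x nNx Sx].
by apply: (lower_integral_swap _ _ _ _ S N) => // x nNx Sx; rewrite !funenegE;
  [have [-> ->] := eqS x nNx Sx|have [-> ->] := eqnS x nNx Sx].
Qed.

Lemma lower_integral_comp_ge (phi : T -> T) (c k : R) F G :
  (0 < c)%R -> (0 < k)%R -> (forall A, measurable A -> measurable (phi @^-1` A)) ->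
  (forall A, measurable A -> mu (phi @^-1` A) = c%:E * mu A) ->
  (forall x, k%:E * F (phi x) <= G x) ->
  (k * c)%:E * lower_integral F <= lower_integral G.
Proof.
move=> c0 k0 mphi cphi FG; have kc0 : (0 < k * c)%R by rewrite mulr_gt0.
rewrite -lee_pdivlMl //; apply: ge_ereal_sup => _ [h /= hF <-].
rewrite lee_pdivlMl // EFinM -muleA.
have mh : measurable_fun setT (h \o phi).
  by move=> _ Y mY; rewrite setTI comp_preimage; apply: mphi; exact: measurable_sfunP.
have finh : finite_set (range (h \o phi)).
  by apply: sub_finite_set (fimfunP h) => _ [x _ <-]; exists (phi x).
have h0 x : (0 <= (h \o phi) x)%R by rewrite /= fun_ge0.
pose g := mk_nnsfun _ _ _ (h \o phi) mh finh h0.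
have -> : c%:E * sintegral mu h = sintegral mu g.
  rewrite !sintegralET ge0_mule_fsumr; last by move=> t; exact: nnsfun_mulemu_ge0.
  apply: eq_fsbigr => t _; rewrite muleCA; congr (_ * _).
  by rewrite [RHS](cphi (h @^-1` [set t])) //; exact: measurable_sfunP.
rewrite -sintegralrM; apply: ereal_sup_ubound.
exists (scale_nnsfun g (ltW k0)) => //= x.
by rewrite EFinM; apply: le_trans (FG x); rewrite lee_pmul2l // hF.
Qed.

(** Change of variables along a bijection that scales the measure. *)
Lemma integral_scale (phi psi : T -> T) (c k : R) (D E : set T) (f g : T -> \bar R) :
  (0 < c)%R -> (0 < k)%R -> cancel phi psi -> cancel psi phi ->
  (forall A, measurable A -> measurable (phi @^-1` A)) ->
  (forall A, measurable A -> measurable (psi @^-1` A)) ->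
  (forall A, measurable A -> mu (phi @^-1` A) = c%:E * mu A) ->
  (forall x, (g \_ E) x = k%:E * (f \_ D) (phi x)) ->
  integral mu E g = (k * c)%:E * integral mu D f.
Proof.
move=> c0 k0 phiK psiK mphi mpsi cphi gf.
have cpsi A : measurable A -> mu (psi @^-1` A) = c^-1%:E * mu A.
  move=> mA; have -> : mu A = c%:E * mu (psi @^-1` A).
    rewrite -cphi; last exact: mpsi.
    by congr (mu _); apply/seteqP; split=> x /=; rewrite phiK.
  by rewrite muleA -EFinM mulVf ?gt_eqF // mul1e.
have scaled (F G : T -> \bar R) : (forall x, G x = k%:E * F (phi x)) ->
    lower_integral G = (k * c)%:E * lower_integral F.
  move=> GF; apply/eqP; rewrite eq_le; apply/andP; split; last first.
    by apply: (@lower_integral_comp_ge phi) => // x; rewrite GF.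
  have kc0 : (0 < k * c)%R by rewrite mulr_gt0.
  rewrite -lee_pdivrMl // invfM.
  apply: (@lower_integral_comp_ge psi); rewrite ?invr_gt0 // => x.
  by rewrite GF psiK muleA -EFinM mulVf ?gt_eqF // mul1e.
rewrite !integral_lower_integral.
rewrite (scaled ((f \_ D)^\+) ((g \_ E)^\+)); last first.
  by move=> x; rewrite !funeposE gf maxeMr ?mule0 // lee_fin ltW.
rewrite (scaled ((f \_ D)^\-) ((g \_ E)^\-)); last first.
  by move=> x; rewrite !funenegE gf maxeMr ?mule0 ?muleN // lee_fin ltW.
by rewrite muleB_gt0 // mulr_gt0.
Qed.

End lower_integral.

(** * Similitudes *)

Section similitudes.
Context {R : realType} {n : nat}.
Implicit Types (a : R) (Q : 'M[R]_n) (b x y : 'rV[R]_n) (E K X : set 'rV[R]_n).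

Definition similitude a Q b x := a *: (x *m Q) + b.

Definition similitude_inv a Q b := similitude a^-1 Q^T (- (a^-1 *: (b *m Q^T))).

Lemma orthogonal_trmx Q : Q *m Q^T = 1%:M -> Q^T *m (Q^T)^T = 1%:M.
Proof. by move=> QQ; rewrite trmxK; apply: mulmx1C. Qed.

Lemma similitudeK a Q b : a != 0 -> Q *m Q^T = 1%:M ->
  cancel (similitude a Q b) (similitude_inv a Q b).
Proof.
move=> a0 QQ x; rewrite /similitude_inv /similitude mulmxDl -scalemxAl -mulmxA QQ mulmx1.
by rewrite scalerDr scalerA mulVf // scale1r addrK.
Qed.

Lemma similitude_invK a Q b : a != 0 -> Q *m Q^T = 1%:M ->
  cancel (similitude_inv a Q b) (similitude a Q b).
Proof.
move=> a0 QQ x; rewrite /similitude_inv /similitude mulmxDl mulNmx -!scalemxAl -!mulmxA.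
rewrite (mulmx1C QQ) !mulmx1 scalerBr !scalerA mulfV // !scale1r.
by rewrite subrK.
Qed.

Lemma dot_orthogonal Q x y : Q *m Q^T = 1%:M -> dot (x *m Q) (y *m Q) = dot x y.
Proof. by move=> QQ; rewrite dot_mulmx -mulmxA QQ mulmx1. Qed.

Lemma enorm_orthogonal Q x : Q *m Q^T = 1%:M -> enorm (x *m Q) = enorm x.
Proof. by move=> QQ; rewrite /enorm dot_orthogonal. Qed.

Lemma enorm_similitude a Q b x y : 0 < a -> Q *m Q^T = 1%:M ->
  enorm (similitude a Q b x - similitude a Q b y) = a * enorm (x - y).
Proof.
move=> a0 QQ; rewrite /similitude opprD addrACA subrr addr0 -scalerBr -mulmxBl.
by rewrite enormZ gtr0_norm // enorm_orthogonal.
Qed.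

Lemma preimage_similitude_inv a Q b X : a != 0 -> Q *m Q^T = 1%:M ->
  similitude_inv a Q b @^-1` X = similitude a Q b @` X.
Proof.
move=> a0 QQ; apply/seteqP; split=> [x Xx|_ [x Xx <-]] /=; last by rewrite similitudeK.
by exists (similitude_inv a Q b x) => //; rewrite similitude_invK.
Qed.

Lemma rigid_motion_similitude (phi : 'rV[R]_n -> 'rV[R]_n) : rigid_motion phi ->
  exists Q b, Q *m Q^T = 1%:M /\ phi = similitude 1 Q b.
Proof.
elim=> [b|Q QQ _|u u1|f g _ [Q [b [QQ ->]]] _ [Q' [b' [QQ' ->]]]].
- exists 1%:M, b; split; first by rewrite trmx1 mulmx1.
  by apply/funext => x; rewrite /similitude mulmx1 scale1r.
- exists Q, 0; split => //.
  by apply/funext => x; rewrite /similitude addr0 scale1r.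
- have uu : u *m u^T = 1%:M.
    apply/rowP => j; rewrite (ord1 j) [RHS]mxE eqxx /=; have := enorm_sq u.
    by rewrite u1 expr1n /dot => <-.
  exists (1%:M - 2 *: (u^T *m u)), 0; split.
    have PP : u^T *m u *m (u^T *m u) = u^T *m u by rewrite mulmxA -(mulmxA u^T) uu mulmx1.
    have PT : (u^T *m u)^T = u^T *m u by rewrite trmx_mul trmxK.
    move: (u^T *m u) PP PT => P PP PT.
    have -> : (1%:M - 2 *: P)^T = 1%:M - 2 *: P.
      by apply/matrixP => i j; rewrite -[in RHS]PT !mxE eq_sym.
    rewrite mulmxBl mul1mx mulmxBr mulmx1 -scalemxAl -scalemxAr PP.
    by apply/matrixP => i j; rewrite !mxE; ring.
  apply/funext => x; rewrite /similitude scale1r addr0 mulmxBr mulmx1 -scalemxAr mulmxA.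
  congr (_ - _); rewrite -scalerA; congr (_ *: _).
  by apply/rowP => j; rewrite !mxE big_ord1 /dot !mxE.
- exists (Q' *m Q), (b' *m Q + b); split.
    by rewrite trmx_mul mulmxA -(mulmxA Q') QQ mulmx1.
  by apply/funext => x /=; rewrite /similitude !scale1r mulmxDl mulmxA addrA.
Qed.

End similitudes.

Section hausdorff_similitude.
Context {R : realType} {n : nat} (s : nat).
Implicit Types (a : R) (Q : 'M[R]_n) (b x y : 'rV[R]_n) (E K X : set 'rV[R]_n).
Local Open Scope ereal_scope.

Let ediam_similitude_le a Q b E (r : R) : (0 < a)%R -> Q *m Q^T = 1%:M ->
  ediam E <= r%:E -> ediam (similitude a Q b @` E) <= (a * r)%:E.
Proof.
move=> a0 QQ Er; apply: ediam_le => _ _ [x Ex <-] [y Ey <-].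
rewrite enorm_similitude // ler_pM2l //; rewrite -lee_fin; apply: le_trans Er.
by apply: ereal_sup_ubound; exists (x, y).
Qed.

Let gauge_similitude_le a Q b E (r : R) : (0 < a)%R -> Q *m Q^T = 1%:M ->
  ediam E <= r%:E ->
  hausdorff_gauge s (similitude a Q b @` E) <= (a ^+ s)%:E * hausdorff_gauge s E.
Proof.
move=> a0 QQ Er; have [->|/set0P E0] := eqVneq E set0.
  by rewrite image_set0 hausdorff_gauge0 mule0.
have d0 := ediam_ge0 E0; case dE : (ediam E) Er d0 => [t|//|//] _ t0.
apply: le_trans (hausdorff_gauge_le s _ (a * t) _ _) _.
- by rewrite mulr_ge0 // ltW.
- by apply: ediam_similitude_le => //; rewrite dE.
rewrite /hausdorff_gauge; case: asboolP => [E00|_]; first by case: E0 => x; rewrite E00.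
by rewrite dE -EFin_expe -!EFinM lee_fin /gauge_cst exprMn mulrCA.
Qed.

Let hausdorff_similitude_le a Q b X : (0 < a)%R -> Q *m Q^T = 1%:M ->
  hausdorff s (similitude a Q b @` X) <= (a ^+ s)%:E * hausdorff s X.
Proof.
move=> a0 QQ; have as0 : (0 < a ^+ s)%R by rewrite exprn_gt0.
apply: ge_ereal_sup => _ [d d0 <-].
have d'0 : (0 < d / a)%R by rewrite divr_gt0.
apply: (@le_trans _ _ ((a ^+ s)%:E * @hausdorff_delta R n s (d / a)%R X)); last first.
  by rewrite lee_pmul2l // ?lte_fin //; apply: ereal_sup_ubound; exists (d / a)%R.
rewrite -lee_pdivrMl //; apply: le_ereal_inf_tmp => _ [E [XE Ed] <-].
rewrite lee_pdivrMl // -nneseriesZl; last by move=> *; exact: hausdorff_gauge_ge0.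
apply: (@le_trans _ _ (\sum_(k <oo) hausdorff_gauge s (similitude a Q b @` E k))).
  apply: ereal_inf_lbound; exists (fun k => similitude a Q b @` E k) => //; split.
    by move=> _ [x /XE[k _ Ex] <-]; exists k => //; exists x.
  move=> k; have -> : d = (a * (d / a))%R by rewrite mulrC divfK // gt_eqF.
  by apply: ediam_similitude_le.
apply: lee_nneseries => [k _ _|k _]; first exact: hausdorff_gauge_ge0.
exact: gauge_similitude_le (Ed k).
Qed.

Lemma hausdorff_similitude a Q b X : (0 < a)%R -> Q *m Q^T = 1%:M ->
  hausdorff s (similitude a Q b @` X) = (a ^+ s)%:E * hausdorff s X.
Proof.
move=> a0 QQ; have as0 : (0 < a ^+ s)%R by rewrite exprn_gt0.
apply/eqP; rewrite eq_le hausdorff_similitude_le //=.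
have an0 : (a != 0)%R by rewrite gt_eqF.
have -> : hausdorff s X = hausdorff s (similitude_inv a Q b @` (similitude a Q b @` X)).
  congr (hausdorff s _); rewrite image_comp (_ : _ \o _ = id) ?image_id //.
  by apply/funext => x /=; rewrite similitudeK.
rewrite -lee_pdivlMl // -exprVn.
by apply: hausdorff_similitude_le; [rewrite invr_gt0|exact: orthogonal_trmx].
Qed.

Lemma caratheodory_similitude a Q b X : (0 < a)%R -> Q *m Q^T = 1%:M ->
  (hausdorff s).-caratheodory X -> (hausdorff s).-caratheodory (similitude a Q b @^-1` X).
Proof.
move=> a0 QQ mX Y; have as0 : (0 < a ^+ s)%R by rewrite exprn_gt0.
have an0 : (a != 0)%R by rewrite gt_eqF.
have -> : hausdorff s Y = (a ^+ s)^-1%:E * hausdorff s (similitude a Q b @` Y).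
  by rewrite hausdorff_similitude // muleA -EFinM mulVf ?mul1e // gt_eqF.
rewrite (mX (similitude a Q b @` Y)) ge0_muleDr ?hausdorff_ge0 //.
have imI B : similitude a Q b @` Y `&` B = similitude a Q b @` (Y `&` similitude a Q b @^-1` B).
  apply/seteqP; split=> [_ [[y Yy <-] By]|_ [y [Yy By] <-]]; first by exists y.
  by split => //; exists y.
by rewrite !imI !hausdorff_similitude // !muleA -EFinM mulVf ?mul1e // gt_eqF.
Qed.

Lemma null_caratheodory X : hausdorff s X = 0 -> (hausdorff s).-caratheodory X.
Proof.
move=> X0; apply: le_caratheodory_measurable => Y.
change (hausdorff s (Y `&` X) + hausdorff s (Y `&` ~` X) <= hausdorff s Y).
rewrite (_ : hausdorff s (Y `&` X) = 0) ?add0e; first exact: le_hausdorff.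
by apply/eqP; rewrite eq_le hausdorff_ge0 andbT -X0; apply: le_hausdorff.
Qed.

End hausdorff_similitude.

(** * Principal curvatures *)

Section symmetric_functions.
Context {R : realType} {m : nat}.
Implicit Types (k : 'I_m -> R).

Definition elem_sym (j : nat) k : R :=
  \sum_(I : {set 'I_m} | #|I| == j) \prod_(i in I) k i.

Lemma elem_sym_perm j k (p : 'S_m) : elem_sym j (k \o p) = elem_sym j k.
Proof.
rewrite /elem_sym [RHS](reindex_inj (imset_inj (@perm_inj _ p))).
apply: eq_big => [I|I _]; first by rewrite card_imset //; exact: perm_inj.
by rewrite big_imset //= => x y _ _; exact: perm_inj.
Qed.

(** Both lists consist of the roots of the same polynomial. *)
Lemma elem_sym_eq_roots j k k' :
  \prod_i ('X - (k i)%:P) = \prod_i ('X - (k' i)%:P) -> elem_sym j k = elem_sym j k'.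
Proof.
have toseq (g : 'I_m -> R) :
    \prod_i ('X - (g i)%:P) = \prod_(x <- [tuple g i | i < m]) ('X - x%:P).
  by rewrite big_map big_enum.
rewrite !toseq => /prod_XsubC_eq /tuple_permP[p kp].
rewrite -(elem_sym_perm j k' p); congr elem_sym; apply/funext => i /=.
have := congr1 (fun t => tnth t i) (val_inj kp).
by rewrite !tnth_mktuple.
Qed.

Lemma elem_symZ j (c : R) k : elem_sym j (fun i => c * k i) = c ^+ j * elem_sym j k.
Proof.
rewrite /elem_sym mulr_sumr; apply: eq_bigr => I /eqP <-.
by rewrite big_split /= prodr_const.
Qed.

Lemma elem_sym_ge0 j k : (forall i, 0 <= k i) -> 0 <= elem_sym j k.
Proof. by move=> k0; apply: sumr_ge0 => I _; apply: prodr_ge0. Qed.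

End symmetric_functions.

Lemma mean_curvatureE {R : realType} {n : nat} (K : set 'rV[R]_n) j x :
  mean_curvature K j x = 'C(n.-1, j)%:R^-1 * elem_sym j (principal_curvatures K x).
Proof. by []. Qed.

Lemma near0_enormP {R : realType} {n : nat} (P : 'rV[R]_n -> Prop) :
  (\forall h \near (0 : 'rV[R]_n), P h) <->
  exists2 d : R, 0 < d & forall h, enorm h < d -> P h.
Proof.
split=> [/nbhs_enormP[d d0 h]|[d d0 h]]; first by exists d => // y yd; apply: h; rewrite subr0.
by apply/nbhs_enormP; exists d => // y; rewrite subr0; exact: h.
Qed.

Section char_poly_similitude.
Context {R : realType} {n : nat}.
Implicit Types (Q A : 'M[R]_n).

Lemma char_poly_orthogonal_scale Q A (c : R) : Q *m Q^T = 1%:M -> c != 0 ->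
  char_poly (c *: (Q^T *m A *m Q)) = c ^+ n *: (char_poly A \Po (c^-1 *: 'X)).
Proof.
move=> QQ c0; have QQ' := mulmx1C QQ.
pose P := map_mx polyC Q; pose P' := map_mx polyC Q^T.
have PP : P' *m P = 1%:M by rewrite -map_mxM QQ' map_mx1.
have detP : \det P' * \det P = 1 by rewrite -det_mulmx PP det1.
have -> : char_poly (c *: (Q^T *m A *m Q)) = \det ('X%:M - c%:P *: map_mx polyC A).
  rewrite /char_poly /char_poly_mx.
  have -> : 'X%:M - map_mx polyC (c *: (Q^T *m A *m Q)) =
      P' *m ('X%:M - c%:P *: map_mx polyC A) *m P.
    rewrite mulmxBr mulmxBl -scalemxAr -scalemxAl mul_mx_scalar -scalemxAl PP scalemx1.
    by rewrite map_mxZ !map_mxM.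
  by rewrite !det_mulmx mulrAC detP mul1r.
have -> : 'X%:M - c%:P *: map_mx polyC A =
    c%:P *: map_mx (fun p => p \Po (c^-1 *: 'X)) (char_poly_mx A).
  apply/matrixP => i j; rewrite !mxE.
  rewrite comp_polyB comp_polyC mulrBr; congr (_ - _).
  case: (i == j); rewrite ?mulr1n ?mulr0n ?comp_poly0 ?mulr0 // comp_polyX.
  by rewrite mul_polyC scalerA mulfV // scale1r.
rewrite detZ.
rewrite (det_map_mx (comp_poly (c^-1 *: 'X))) -polyC_exp mul_polyC.
by [].
Qed.

Lemma char_poly_similitude Q A (c : R) (k : 'I_n.-1 -> R) : (0 < n)%N ->
  Q *m Q^T = 1%:M -> c != 0 -> char_poly A = 'X * \prod_i ('X - (k i)%:P) ->
  char_poly (c *: (Q^T *m A *m Q)) = 'X * \prod_i ('X - (c * k i)%:P).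
Proof.
move=> n0 QQ c0 charA; rewrite char_poly_orthogonal_scale // charA.
rewrite comp_polyM rmorph_prod /= comp_polyX.
have -> : \prod_i ('X - (c * k i)%:P) = \prod_i (c *: (('X - (k i)%:P) \Po (c^-1 *: 'X))).
  apply: eq_bigr => i _; rewrite comp_polyB comp_polyX comp_polyC scalerBr scalerA mulfV //.
  by rewrite scale1r -[X in _ = _ - X]mul_polyC polyCM.
rewrite scaler_prod prodr_const card_ord -scalerAr -scalerAl scalerA; congr (_ *: _).
by rewrite -(prednK n0) exprSr mulfK.
Qed.

End char_poly_similitude.

Section principal_curvatures_uniqueness.
Context {R : realType} {n : nat}.
Implicit Types (K : set 'rV[R]_n) (x u v h : 'rV[R]_n) (A : 'M[R]_n) (f : 'rV[R]_n -> R).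

(** The point x - r v + r u of the inner ball is on the wrong side of the
hyperplane orthogonal to u, unless u = v. *)
Lemma outer_unit_normal_unique K x u v (r : R) : 0 < r -> enorm v = 1 ->
  eball (x - r *: v) r `<=` K -> outer_unit_normal K x u -> u = v.
Proof.
move=> r0 v1 ballK [u1 uK].
have uu : dot u u = 1 by rewrite -enorm_sq u1 expr1n.
have vv : dot v v = 1 by rewrite -enorm_sq v1 expr1n.
have : K (x - r *: v + r *: u).
  by apply: ballK; rewrite /eball /= addrC addKr enormZ u1 mulr1 ger0_norm // ltW.
move/uK; rewrite addrAC (addrC x) addrK !dot_linear uu => h.
have vu : 1 <= dot v u by rewrite -(ler_pM2l r0); lra.
apply/eqP; rewrite -subr_eq0 -dot_eq0 eq_le dot_ge0 andbT !dot_linear uu vv (dotC u v).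
lra.
Qed.

Lemma boundary_graph_ge0 K x u f : outer_unit_normal K x u -> boundary_graph K x u f ->
  \forall h \near (0 : 'rV[R]_n), dot h u = 0 -> 0 <= f h.
Proof.
move=> [u1 uK] /near0_enormP[d d0 hd]; apply/near0_enormP; exists d => // h hh hu.
have uu : dot u u = 1 by rewrite -enorm_sq u1 expr1n.
have [/uK] := hd h hh hu; rewrite addrAC (addrC x) addrK !dot_linear uu hu.
by move=> h1 _; lra.
Qed.

(** By homogeneity, it is enough to control the form near 0 up to o(|h|^2). *)
Lemma quadratic_ge0_of_near u A :
  (forall e : R, 0 < e -> \forall h \near (0 : 'rV[R]_n), dot h u = 0 ->
     - (e * dot h h) <= dot (h *m A) h) ->
  forall h, dot h u = 0 -> 0 <= dot (h *m A) h.
Proof.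
move=> H h hu; rewrite leNgt; apply/negP => hA.
have hh0 : 0 < dot h h.
  rewrite lt_neqAle dot_ge0 andbT eq_sym dot_eq0; apply/eqP => h0.
  by move: hA; rewrite h0 mul0mx dot0l ltxx.
pose e := - dot (h *m A) h / (2 * dot h h).
have e0 : 0 < e by rewrite divr_gt0 ?oppr_gt0 // mulr_gt0.
have /near0_enormP[d d0 hd] := H e e0.
have h1 : 0 < enorm h + 1 by rewrite ltr_wpDl ?enorm_ge0.
pose t := d / 2 / (enorm h + 1).
have t0 : 0 < t by rewrite !divr_gt0.
have ht : enorm (t *: h) < d.
  rewrite enormZ gtr0_norm // /t mulrAC ltr_pdivrMr //.
  by have := enorm_ge0 h; nra.
have := hd (t *: h) ht; rewrite -scalemxAl !dot_linear hu mulr0 => /(_ erefl).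
have ew : e * dot h h = - dot (h *m A) h / 2 by rewrite /e; field; rewrite gt_eqF.
have -> : e * (t * (t * dot h h)) = t * t * (e * dot h h) by ring.
have tt0 : 0 < t * t by rewrite mulr_gt0.
by rewrite ew; move: hA tt0; set q := dot (h *m A) h; nra.
Qed.

Lemma second_order_ge0 K x u f A : outer_unit_normal K x u -> boundary_graph K x u f ->
  second_order u f A -> forall h, dot h u = 0 -> 0 <= dot (h *m A) h.
Proof.
move=> nu gf so; apply: (quadratic_ge0_of_near u A) => e e0.
have /near0_enormP[d d0 hd] := boundary_graph_ge0 _ _ _ _ nu gf.
have /near0_enormP[d' d'0 hd'] := so (e / 2) (divr_gt0 e0 (ltr0n R 2)).
apply/near0_enormP; exists (Num.min d d'); first by rewrite lt_min d0.
move=> h; rewrite lt_min => /andP[h1 h2] hu.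
have := hd h h1 hu; have := hd' h h2 hu; rewrite ler_norml => /andP[].
by set q := dot (h *m A) h; set w := dot h h; lra.
Qed.

(** Two graphs of the same boundary agree near 0, so the two forms agree on the
orthogonal complement of u; both are symmetric and vanish along u. *)
Lemma second_order_unique K x u f f' A A' :
  boundary_graph K x u f -> boundary_graph K x u f' ->
  second_order u f A -> second_order u f' A' ->
  A^T = A -> A'^T = A' -> u *m A = 0 -> u *m A' = 0 -> dot u u = 1 -> A = A'.
Proof.
move=> gf gf' so so' AT AT' uA uA' uu.
have ff' : \forall h \near (0 : 'rV[R]_n), dot h u = 0 -> f h = f' h.
  have /near0_enormP[d d0 hd] := gf; have /near0_enormP[d' d'0 hd'] := gf'.
  apply/near0_enormP; exists (Num.min d d'); first by rewrite lt_min d0.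
  move=> h; rewrite lt_min => /andP[h1 h2] hu.
  have [K1 m1] := hd h h1 hu; have [K2 m2] := hd' h h2 hu.
  by apply/eqP; rewrite eq_le m1 // m2.
have near_eq (e : R) : 0 < e -> \forall h \near (0 : 'rV[R]_n), dot h u = 0 ->
    `|dot (h *m A) h - dot (h *m A') h| <= e * dot h h.
  move=> e0; have e4 : 0 < e / 4 by rewrite divr_gt0.
  have /near0_enormP[d d0 hd] := ff'.
  have /near0_enormP[d1 d10 hd1] := so _ e4; have /near0_enormP[d2 d20 hd2] := so' _ e4.
  apply/near0_enormP; exists (Num.min d (Num.min d1 d2)); first by rewrite !lt_min d0 d10.
  move=> h; rewrite !lt_min => /and3P[h0 h1 h2] hu.
  have := hd1 h h1 hu; have := hd2 h h2 hu; rewrite (hd h h0 hu) !ler_norml.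
  set a := dot (h *m A) h; set b := dot (h *m A') h; set w := dot h h.
  by move=> /andP[i1 i2] /andP[i3 i4]; apply/andP; split; lra.
have quad_eq h : dot h u = 0 -> dot (h *m (A - A')) h = 0.
  move=> hu; apply/eqP; rewrite eq_le; apply/andP; split.
    rewrite -oppr_ge0 -dotNl -mulmxN.
    apply: (quadratic_ge0_of_near u) hu => e /near_eq /near0_enormP[d d0 hd].
    apply/near0_enormP; exists d => // g gd gu; have := hd g gd gu.
    by rewrite ler_norml mulmxN dotNl mulmxBr dotBl; lra.
  apply: (quadratic_ge0_of_near u) hu => e /near_eq /near0_enormP[d d0 hd].
  apply/near0_enormP; exists d => // g gd gu; have := hd g gd gu.
  by rewrite ler_norml mulmxBr dotBl; lra.
pose D := A - A'.
have DT : D^T = D by rewrite /D linearB /= AT AT'.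
have uD : u *m D = 0 by rewrite /D mulmxBr uA uA' subrr.
have quad0 v : dot (v *m D) v = 0.
  have -> : v = (v - dot v u *: u) + dot v u *: u by rewrite subrK.
  set h := v - _; have hu : dot h u = 0 by rewrite /h dotBl dotZl uu mulr1 subrr.
  rewrite mulmxDl -scalemxAl uD scaler0 addr0 dotDr quad_eq // add0r dotZr.
  by rewrite dot_mulmx DT uD dot0r mulr0.
have bil0 v w : dot (v *m D) w = 0.
  have := quad0 (v + w); rewrite mulmxDl !dot_linear !quad0 (dot_mulmx _ w) DT (dotC w).
  lra.
apply/eqP; rewrite -subr_eq0; apply/eqP/matrixP => i j; rewrite mxE.
have := bil0 (delta_mx ord0 i) (delta_mx ord0 j).
rewrite -rowE /dot trmx_delta -colE !mxE.
by [].
Qed.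

(** At a boundary point touched by an inner ball, the symmetric functions of the
curvatures do not depend on the data through which these are defined. *)
Lemma principal_curvatures_unique K x (v : 'rV[R]_n) (r : R) k k' j : 0 < r ->
  enorm v = 1 -> eball (x - r *: v) r `<=` K ->
  is_principal_curvatures K x k -> is_principal_curvatures K x k' ->
  elem_sym j k = elem_sym j k'.
Proof.
move=> r0 v1 ballK [u [f [A [nu gf so [AT uA] cA]]]] [u' [f' [A' [nu' gf' so' [AT' uA'] cA']]]].
have eu := outer_unit_normal_unique _ _ _ _ _ r0 v1 ballK nu.
have eu' := outer_unit_normal_unique _ _ _ _ _ r0 v1 ballK nu'.
subst u; subst u'.
have vv : dot v v = 1 by rewrite -enorm_sq v1 expr1n.
have AA' := second_order_unique _ _ _ _ _ _ _ gf gf' so so' AT AT' uA uA' vv.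
apply: elem_sym_eq_roots; apply: (mulfI (negbT (polyX_eq0 R))).
by rewrite -cA -cA' AA'.
Qed.

(** An eigenvector for a nonzero eigenvalue is orthogonal to u, where the form is
nonnegative since K is below its supporting hyperplane. *)
Lemma principal_curvatures_ge0 K x k i : is_principal_curvatures K x k -> 0 <= k i.
Proof.
move=> [u [f [A [nu gf so [AT uA] cA]]]].
have /eigenvalueP[v vA v0] : eigenvalue A (k i).
  by rewrite eigenvalue_root_char cA rootM (bigD1 i) //= rootM root_XsubC eqxx !orbT.
rewrite leNgt; apply/negP => ki.
have vu : dot v u = 0.
  have : dot (v *m A) u = 0 by rewrite dot_mulmx AT uA dot0r.
  by rewrite vA dotZl => /eqP; rewrite mulf_eq0 lt_eqF //= => /eqP.
have := second_order_ge0 _ _ _ _ _ nu gf so v vu; rewrite vA dotZl.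
rewrite leNgt nmulr_rlt0 // lt_neqAle dot_ge0 eq_sym dot_eq0 v0.
by [].
Qed.

Lemma principal_curvatures_ge0_default K x i : 0 <= principal_curvatures K x i.
Proof.
rewrite /principal_curvatures; case: xgetP => [k _|_] //.
exact: principal_curvatures_ge0.
Qed.

End principal_curvatures_uniqueness.

(** * Invariance and homogeneity *)

Section curvature_integrand.
Context {R : realType} {n : nat}.
Implicit Types (K : set 'rV[R]_n).

Definition integrand_W1 (k : nat) K (x : 'rV[R]_n) : R :=
  mean_curvature K n.-1 x `^ (1 / (n%:R + 1)) * curvature_sum 1 k K x.

Lemma quermass_W1E k K : quermass_W1 k K =
  integral (@hausdorff_measure R n n.-1) (boundary K) (EFin \o integrand_W1 k K).
Proof. by []. Qed.

Lemma integrand_W1_scale (k : nat) K L (x y : 'rV[R]_n) (c : R) : 0 < c ->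
  (forall i, 0 <= principal_curvatures K x i) ->
  (forall j, elem_sym j (principal_curvatures L y) =
     elem_sym j (fun i => c * principal_curvatures K x i)) ->
  integrand_W1 k L y = c `^ (n.-1%:R / (n%:R + 1) + k%:R) * integrand_W1 k K x.
Proof.
move=> c0 K0 LK; have c0' := ltW c0.
have H j : mean_curvature L j y = c ^+ j * mean_curvature K j x.
  by rewrite !mean_curvatureE LK elem_symZ mulrCA.
have HK j : 0 <= mean_curvature K j x.
  by rewrite mean_curvatureE mulr_ge0 ?invr_ge0 ?ler0n // elem_sym_ge0.
rewrite /integrand_W1 H powRM ?exprn_ge0 // -powR_mulrn // -powRrM.
rewrite powRD; last by apply/implyP => _; rewrite gt_eqF.
have -> : curvature_sum 1 k L y = c `^ k%:R * curvature_sum 1 k K x.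
  rewrite powR_mulrn // /curvature_sum mulr_sumr; apply: eq_bigr => i /eqP ik.
  rewrite mulrCA; congr (_ * _).
  have -> : c ^+ k = \prod_(j < n.-1) c ^+ (j.+1 * i j) by rewrite prodrXr ik.
  rewrite -big_split /=; apply: eq_bigr => j _.
  by rewrite H exprMn -exprM mulrCA.
by rewrite mul1r; ring.
Qed.

End curvature_integrand.

Section similitude_equivariance.
Context {R : realType} {n : nat}.
Variables (a : R) (Q : 'M[R]_n) (b : 'rV[R]_n).
Hypotheses (a0 : 0 < a) (QQ : Q *m Q^T = 1%:M).
Local Notation phi := (similitude a Q b).
Implicit Types (K : set 'rV[R]_n) (x : 'rV[R]_n).

Let an0 : a != 0. Proof. by rewrite gt_eqF. Qed.

Lemma similitude_line x h u (t : R) :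
  phi x + h - t *: (u *m Q) = phi (x + a^-1 *: (h *m Q^T) - (t / a) *: u).
Proof.
rewrite /similitude !mulmxBl mulmxDl -!scalemxAl -mulmxA (mulmx1C QQ) mulmx1.
rewrite !scalerBr scalerDr !scalerA mulfV // scale1r mulrCA mulfV // mulr1.
by rewrite [RHS]addrAC; congr (_ - _); rewrite addrAC.
Qed.

Lemma mem_similitude K x : (phi @` K) (phi x) <-> K x.
Proof.
split=> [[y Ky /(can_inj (similitudeK a Q b an0 QQ)) <-]//|Kx]; by exists x.
Qed.

Lemma boundary_similitude K x : boundary (phi @` K) (phi x) <-> boundary K x.
Proof.
have inv y : y = phi (similitude_inv a Q b y) by rewrite similitude_invK.
have norm_phi y z : enorm (phi y - phi z) = a * enorm (y - z) by rewrite enorm_similitude.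
have clE : closure (phi @` K) (phi x) <-> closure K x.
  split=> /closure_enormP h; apply/closure_enormP => e e0.
    have [_ [y Ky <-]] := h (a * e) (mulr_gt0 a0 e0).
    by rewrite norm_phi ltr_pM2l // => ye; exists y.
  have [y Ky ye] := h (e / a) (divr_gt0 e0 a0); exists (phi y); first by exists y.
  by rewrite norm_phi -ltr_pdivlMl // mulrC.
have intE : (phi @` K)° (phi x) <-> K° x.
  split=> /interior_enormP[e e0 h]; apply/interior_enormP.
    exists (e / a); first by rewrite divr_gt0.
    move=> y ye; apply/mem_similitude; apply: h.
    by rewrite norm_phi -ltr_pdivlMl // mulrC.
  exists (a * e); first by rewrite mulr_gt0.
  by move=> y; rewrite (inv y) norm_phi ltr_pM2l // => /h Ky; apply/mem_similitude.
by rewrite /boundary /setD /mkset clE intE.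
Qed.

Hypothesis n0 : (0 < n)%N.

Lemma principal_curvatures_similitude K x k : is_principal_curvatures K x k ->
  is_principal_curvatures (phi @` K) (phi x) (fun i => a^-1 * k i).
Proof.
move=> [u [f [A [[u1 uK] gf so [AT uA] cA]]]].
pose back (h : 'rV[R]_n) := a^-1 *: (h *m Q^T).
have QQ' : Q^T *m (Q^T)^T = 1%:M by exact: orthogonal_trmx.
have back_perp h : dot h (u *m Q) = 0 -> dot (back h) u = 0.
  by move=> hu; rewrite /back dotZl dot_mulmx trmxK hu mulr0.
have back_norm h : enorm (back h) = a^-1 * enorm h.
  by rewrite /back enormZ enorm_orthogonal // gtr0_norm // invr_gt0.
have back_near (P : 'rV[R]_n -> Prop) : (\forall h \near (0 : 'rV[R]_n), P h) ->
    \forall h \near (0 : 'rV[R]_n), P (back h).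
  move=> /near0_enormP[d d0 hd]; apply/near0_enormP; exists (a * d); first by rewrite mulr_gt0.
  by move=> h hh; apply: hd; rewrite back_norm ltr_pdivrMl.
exists (u *m Q), (fun h => a * f (back h)), (a^-1 *: (Q^T *m A *m Q)); split.
- split; first by rewrite enorm_orthogonal.
  move=> _ [y Ky <-]; rewrite /similitude opprD addrACA subrr addr0 -scalerBr -mulmxBl.
  by rewrite dotZl dot_orthogonal // pmulr_rle0 // uK.
- have := back_near _ gf; apply: filterS => h hh /back_perp/hh[Kh hmin]; split.
    by rewrite similitude_line; apply/mem_similitude; rewrite mulrC mulKf.
  move=> t; rewrite similitude_line => /mem_similitude/hmin.
  by rewrite ler_pdivlMr // mulrC.
- move=> e e0; have := back_near _ (so (a * e) (mulr_gt0 a0 e0)).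
  apply: filterS => h hh /back_perp/hh {hh}.
  have -> : dot (h *m (a^-1 *: (Q^T *m A *m Q))) h = a * dot (back h *m A) (back h).
    rewrite /back -scalemxAr -scalemxAl !dot_linear !mulmxA [dot (_ *m Q) h]dot_mulmx.
    by field.
  have -> : dot h h = a ^+ 2 * dot (back h) (back h).
    rewrite /back !dot_linear dot_orthogonal //; by field.
  set q := dot (back h *m A) _; set w := dot (back h) _.
  have -> : a * f (back h) - 2^-1 * (a * q) = a * (f (back h) - 2^-1 * q) by ring.
  rewrite normrM gtr0_norm // => h1; have -> : e * (a ^+ 2 * w) = a * (a * e * w) by ring.
  by rewrite ler_pM2l.
- split; last by rewrite -scalemxAr !mulmxA -(mulmxA u) QQ mulmx1 uA mul0mx scaler0.
  by rewrite linearZ /= !trmx_mul trmxK AT mulmxA.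
- by apply: char_poly_similitude => //; rewrite invr_neq0.
Qed.

End similitude_equivariance.

Section similitude_W1.
Context {R : realType} {n : nat}.

Lemma principal_curvatures_similitudeE (a : R) (Q : 'M[R]_n) b K x k :
  0 < a -> Q *m Q^T = 1%:M -> (0 < n)%N ->
  is_principal_curvatures (similitude a Q b @` K) (similitude a Q b x) k ->
  is_principal_curvatures K x (fun i => a * k i).
Proof.
move=> a0 QQ n0; have an0 : a != 0 by rewrite gt_eqF.
have := @principal_curvatures_similitude R n a^-1 Q^T (- (a^-1 *: (b *m Q^T))).
rewrite invr_gt0 => /(_ a0 (orthogonal_trmx _ QQ) n0) h /h.
rewrite -/(similitude_inv a Q b) similitudeK // image_comp.
rewrite (_ : _ \o _ = id) ?image_id; last by apply/funext => y /=; rewrite similitudeK.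
by rewrite invrK.
Qed.

(** The two sides are computed from unrelated choices of curvatures at x and at
its image; both values are 0 where there are no curvatures. *)
Lemma elem_sym_similitude (a r : R) (Q : 'M[R]_n) b K x v j :
  0 < a -> Q *m Q^T = 1%:M -> (0 < n)%N ->
  0 < r -> enorm v = 1 -> eball (x - r *: v) r `<=` K ->
  elem_sym j (principal_curvatures (similitude a Q b @` K) (similitude a Q b x)) =
  elem_sym j (fun i => a^-1 * principal_curvatures K x i).
Proof.
move=> a0 QQ n0 r0 v1 ballK; set k' := principal_curvatures (_ @` _) _.
rewrite /principal_curvatures; case: xgetP => [k _ pk|nk].
  have pk' : is_principal_curvatures (similitude a Q b @` K) (similitude a Q b x) k'.
    rewrite /k' /principal_curvatures; case: xgetP => // nk'.
    have := principal_curvatures_similitude a Q b a0 QQ n0 K x k pk.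
    by move=> h; exfalso; apply: (nk' (fun i => a^-1 * k i)).
  have := principal_curvatures_similitudeE _ _ _ _ _ _ a0 QQ n0 pk' => pk''.
  have := principal_curvatures_unique _ _ _ _ _ _ j r0 v1 ballK pk'' pk.
  rewrite !elem_symZ => <-.
  by rewrite mulrA -exprMn mulVf ?expr1n ?mul1r // gt_eqF.
have -> : k' = fun=> 0.
  rewrite /k' /principal_curvatures; case: xgetP => // k'' _ pk''.
  by have /nk := principal_curvatures_similitudeE _ _ _ _ _ _ a0 QQ n0 pk''.
by congr elem_sym; apply/funext => i; rewrite mulr0.
Qed.

(** The integrand contributes the exponent -(n-1)/(n+1) - k, and the measure
contributes n-1. *)
Lemma quermass_W1_similitude (k : nat) (a : R) (Q : 'M[R]_n) b (K : set 'rV[R]_n) :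
  (0 < n)%N -> 0 < a -> Q *m Q^T = 1%:M -> inner_rolling_ball K ->
  quermass_W1 k (similitude a Q b @` K) =
  ((a `^ (n%:R * ((n%:R - 1) / (n%:R + 1)) - k%:R))%:E * quermass_W1 k K)%E.
Proof.
move=> n0 a0 QQ [r r0 ballK]; have an0 : a != 0 by rewrite gt_eqF.
have ai0 : 0 < a^-1 by rewrite invr_gt0.
pose c := a^-1 `^ (n.-1%:R / (n%:R + 1) + k%:R).
have c0 : 0 < c by rewrite powR_gt0.
have as0 : 0 < a ^+ n.-1 by rewrite exprn_gt0.
rewrite !quermass_W1E.
have -> : a `^ (n%:R * ((n%:R - 1) / (n%:R + 1)) - k%:R) = c * a ^+ n.-1.
  rewrite /c -[a^-1]powR_inv1 ?(ltW a0) // -powRrM -powR_mulrn ?(ltW a0) // -powRD; last first.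
    by apply/implyP.
  congr (_ `^ _); rewrite -[in n%:R](prednK n0) -natr1.
  by field; rewrite !natr1 pnatr_eq0.
have := @integral_scale _ _ R (@hausdorff_measure R n n.-1)
  (similitude_inv a Q b) (similitude a Q b) (a ^+ n.-1) c
  (boundary K) (boundary (similitude a Q b @` K))
  (EFin \o integrand_W1 k K) (EFin \o integrand_W1 k (similitude a Q b @` K)) as0 c0.
apply => //.
- by move=> x; rewrite similitude_invK.
- by move=> x; rewrite similitudeK.
- move=> A mA; apply: caratheodory_similitude => //; exact: orthogonal_trmx.
- by move=> A mA; apply: caratheodory_similitude.
- by move=> A mA; rewrite preimage_similitude_inv //; exact: hausdorff_similitude.
move=> y; rewrite -[y](similitude_invK a Q b) // similitudeK //.
set x := similitude_inv a Q b y; rewrite /patch.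
have -> : (similitude a Q b x \in boundary (similitude a Q b @` K)) = (x \in boundary K).
  by apply/idP/idP => /set_mem/boundary_similitude h; apply/mem_set; exact: h.
case: ifPn => [/set_mem/ballK[v [v1 vK] vball]|_]; last by rewrite mule0.
rewrite /= -EFinM; congr EFin; apply: integrand_W1_scale => //.
  by move=> i; exact: principal_curvatures_ge0_default.
by move=> j; exact: (elem_sym_similitude _ _ _ _ _ _ _ _ a0 QQ n0 r0 v1 vball).
Qed.

End similitude_W1.

(** * Curvature of convex sets is local *)

Section convexity.
Context {R : realType} {n : nat}.
Implicit Types (K L M : set 'rV[R]_n) (x y u h : 'rV[R]_n).

Definition segment_closed K := forall x y (t : R), K x -> K y -> 0 <= t -> t <= 1 ->
  K (x + t *: (y - x)).

Lemma convex_segment_closed K : convex_set (K : set (convex_lmodType 'rV[R]_n)) ->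
  segment_closed K.
Proof.
move=> cK x y t Kx Ky t0 t1.
have := cK y x (Itv01 t0 t1) (mem_set Ky) (mem_set Kx) => /set_mem.
rewrite /conv /=; congr K.
by apply/rowP => i; rewrite !mxE /= /unstable.onem; ring.
Qed.

Lemma segment_closedI K L : segment_closed K -> segment_closed L -> segment_closed (K `&` L).
Proof. by move=> cK cL x y t [Kx Lx] [Ky Ly] t0 t1; split; [exact: cK|exact: cL]. Qed.

Lemma boundary_closedE K x : closed K -> boundary K x <-> K x /\ ~ K° x.
Proof. by move=> cK; rewrite /boundary -(proj1 (closure_id K) cK). Qed.

(** x is in the interior of the convex hull of (1 + t) x and of a ball around
the origin. *)
Lemma interior_of_ray K x (t : R) : segment_closed K -> K° 0 -> 0 < t ->
  K ((1 + t) *: x) -> K° x.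
Proof.
move=> cK /interior_enormP[e e0 he] t0 Kx; apply/interior_enormP.
pose l := (1 + t)^-1; have t1 : 0 < 1 + t by lra.
have l0 : 0 < l by rewrite invr_gt0.
have l1 : l < 1 by rewrite invf_lt1 //; lra.
exists (e * (1 - l)); first by rewrite mulr_gt0 // subr_gt0.
move=> y yx; pose z := (1 - l)^-1 *: (y - x).
have l1' : 0 < 1 - l by rewrite subr_gt0.
have Kz : K z.
  apply: he; rewrite subr0 /z enormZ gtr0_norm ?invr_gt0 //.
  by rewrite mulrC ltr_pdivrMr.
have -> : y = z + l *: ((1 + t) *: x - z).
  have lt : l * (1 + t) = 1 by rewrite mulVf // gt_eqF.
  rewrite scalerBr scalerA lt scale1r addrCA -[X in _ + (X - _)]scale1r -scalerBl.
  by rewrite /z scalerA mulfV ?gt_eqF // scale1r addrC subrK.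
by apply: cK => //; exact: ltW.
Qed.

Definition agree_near K M x := exists2 e : R, 0 < e & forall y, enorm (y - x) < e -> K y <-> M y.

Lemma agree_near_sym K M x : agree_near K M x -> agree_near M K x.
Proof. by move=> [e e0 h]; exists e => // y /h ->. Qed.

Lemma agree_near_boundary K M x : agree_near K M x -> boundary K x -> boundary M x.
Proof.
move=> [e e0 h] [/closure_enormP cK nK]; split.
  apply/closure_enormP => d d0; have [|y Ky] := cK (Num.min d e); first by rewrite lt_min d0.
  by rewrite lt_min => /andP[yd ye]; exists y => //; apply/(h y ye).
move=> /interior_enormP[d d0 hd]; apply: nK; apply/interior_enormP.
exists (Num.min d e); first by rewrite lt_min d0.
by move=> y; rewrite lt_min => /andP[yd ye]; apply/(h y ye)/hd.
Qed.

Lemma quadratic_le (A : 'M[R]_n) : exists2 c : R, 0 <= c &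
  forall h : 'rV[R]_n, `|dot (h *m A) h| <= c * dot h h.
Proof.
exists (\sum_i enorm (row i A)); first by rewrite sumr_ge0 // => i _; exact: enorm_ge0.
move=> h; apply: le_trans (dot_abs_le _ _) _; rewrite -enorm_sq expr2 mulrA.
rewrite ler_wpM2r ?enorm_ge0 // mulmx_sum_row; apply: le_trans (enorm_sum _ _) _.
rewrite mulr_suml; apply: ler_sum => i _; rewrite enormZ mulrC.
by rewrite ler_wpM2l ?enorm_ge0 // coord_le_enorm.
Qed.

(** The second-order expansion forces the graph to be continuous at 0. *)
Lemma boundary_graph_small u f A : second_order u f A -> forall e : R, 0 < e ->
  \forall h \near (0 : 'rV[R]_n), dot h u = 0 -> `|f h| < e.
Proof.
move=> so e e0; have [c c0 hc] := quadratic_le A.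
have /near0_enormP[d d0 hd] := so 1 ltr01; pose c1 := c + 1.
have c10 : 0 < c1 by rewrite ltr_wpDl.
apply/near0_enormP; exists (Num.min d (Num.min 1 (e / c1))).
  by rewrite !lt_min d0 ltr01 divr_gt0.
move=> h; rewrite !lt_min => /and3P[h1 h2 h3] hu.
have := hd h h1 hu; have := hc h; rewrite -enorm_sq mul1r.
move: h3; rewrite ltr_pdivlMr // /c1; have := enorm_ge0 h.
rewrite !ler_norml ltr_norml; set q := dot _ _; set w := enorm h in h2 *.
move=> w0 wc /andP[q1 q2] /andP[f1 f2].
have ww : w ^+ 2 <= w by nra.
have : c * w ^+ 2 + w ^+ 2 <= w * (c + 1) by nra.
have : 0 <= c * w ^+ 2 by rewrite mulr_ge0 ?sqr_ge0.
by move=> *; apply/andP; split; lra.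
Qed.

(** The outer normal and the minimality in [boundary_graph] are global
conditions, but a point violating one of them violates it arbitrarily close to x,
along a segment. *)
Lemma principal_curvatures_local K M x k : segment_closed K -> segment_closed M ->
  K x -> M x -> agree_near K M x -> is_principal_curvatures K x k ->
  is_principal_curvatures M x k.
Proof.
move=> cK cM Kx Mx [e e0 KM] [u [f [A [[u1 uK] gf so AA cA]]]].
have step y (d : R) : 0 < d -> exists2 t, 0 < t & t <= 1 /\ enorm (t *: y) < d.
  move=> d0; have y1 : 0 < enorm y + 1 by rewrite ltr_wpDl ?enorm_ge0.
  exists (Num.min 1 (d / 2 / (enorm y + 1))); first by rewrite lt_min ltr01 !divr_gt0.
  split; first by rewrite ge_min lexx.
  set t := Num.min _ _; have t0 : 0 <= t by rewrite le_min ler01 !divr_ge0 // ltW.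
  have : t <= d / 2 / (enorm y + 1) by rewrite ge_min lexx orbT.
  rewrite enormZ ger0_norm // ler_pdivlMr // => h.
  by have := enorm_ge0 y; nra.
exists u, f, A; split => //.
- split=> // y My; have [t t0 [t1 ty]] := step (y - x) e e0.
  have : K (x + t *: (y - x)).
    by apply/KM; [rewrite addrC addKr|apply: cM => //; exact: ltW].
  by move/uK; rewrite addrC addKr dotZl pmulr_rle0.
- have /near0_enormP[d d0 hd] := gf.
  have /near0_enormP[d' d'0 hd'] := boundary_graph_small _ _ _ so (e / 4) (divr_gt0 e0 (ltr0n R 4)).
  apply/near0_enormP; exists (Num.min (Num.min d d') (e / 4)).
    by rewrite !lt_min d0 d'0 divr_gt0.
  move=> h; rewrite !lt_min => /andP[/andP[h1 h2] h3] hu.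
  have [Kf fmin] := hd h h1 hu; have fe := hd' h h2 hu.
  have near_f : enorm (x + h - f h *: u - x) < e / 2.
    rewrite addrAC (addrC x) addrK; apply: le_lt_trans (enormD _ _) _.
    by rewrite enormN enormZ u1 mulr1; lra.
  split; first by apply/KM => //; lra.
  move=> t Mt; rewrite leNgt; apply/negP => tf.
  pose v := (f h - t) *: u.
  have [l l0 [l1 lv]] := step v (e / 2) (divr_gt0 e0 (ltr0n R 2)).
  have eq_pt : x + h - f h *: u + l *: (x + h - t *: u - (x + h - f h *: u)) =
      x + h - (f h - l * (f h - t)) *: u.
    by apply/rowP => i; rewrite !mxE; ring.
  have eq_v : x + h - t *: u - (x + h - f h *: u) = v.
    by apply/rowP => i; rewrite !mxE; ring.
  have : K (x + h - (f h - l * (f h - t)) *: u).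
    apply/KM; rewrite -eq_pt.
      rewrite eq_v addrAC; apply: le_lt_trans (enormD _ _) _; lra.
    by apply: cM => //; [apply/KM => //; lra|exact: ltW].
  move/fmin; rewrite leNgt => /negP; apply.
  by rewrite ltrBlDr ltrDl mulr_gt0 // subr_gt0.
Qed.

Lemma integrand_W1_eq k K M x :
  (forall c, is_principal_curvatures K x c <-> is_principal_curvatures M x c) ->
  integrand_W1 k K x = integrand_W1 k M x.
Proof.
move=> KM; have KMx : principal_curvatures K x = principal_curvatures M x.
  by rewrite /principal_curvatures; congr xget; apply/seteqP; split=> c /=; rewrite KM.
have H j : mean_curvature K j x = mean_curvature M j x by rewrite !mean_curvatureE KMx.
rewrite /integrand_W1 H; congr (_ * _); apply: eq_bigr => i _; congr (_ * _).
by apply: eq_bigr => j _; rewrite H.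
Qed.

Lemma integrand_W1_local k K M x : segment_closed K -> segment_closed M ->
  K x -> agree_near K M x -> integrand_W1 k K x = integrand_W1 k M x.
Proof.
move=> cK cM Kx KM; have Mx : M x.
  by have [e e0 h] := KM; apply/h => //; rewrite subrr enorm0.
apply: integrand_W1_eq => c; split; apply: principal_curvatures_local => //.
exact: agree_near_sym.
Qed.

End convexity.

(** * Sets squeezed between a tangent ball and a half-space *)

Section sandwich.
Context {R : realType} {n : nat}.
Variables (C I U : set 'rV[R]_n) (nu : 'rV[R]_n -> 'rV[R]_n) (r : R).
Hypothesis r0 : 0 < r.
Hypothesis nu_unit : forall c, C c -> enorm (nu c) = 1.
Hypothesis ball_in : forall c, C c -> eball (c - r *: nu c) r `<=` I.
Hypothesis below : forall c y, C c -> U y -> dot (y - c) (nu c) <= 0.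
Implicit Types (M : set 'rV[R]_n) (x u h p : 'rV[R]_n).

Hypothesis IU : I `<=` U.

(** The balls make nu Lipschitz; only the angle matters here. *)
Let normal_continuity x c : C x -> C c -> enorm (x - c) <= r / 2 ->
  2^-1 <= dot (nu x) (nu c).
Proof.
move=> Cx Cc xc.
have xx : dot (nu x) (nu x) = 1 by rewrite -enorm_sq nu_unit // expr1n.
have : U (c - r *: nu c + r *: nu x).
  apply/IU/(ball_in c) => //; rewrite /eball /= addrC addKr enormZ nu_unit // mulr1.
  by rewrite ger0_norm // ltW.
move/(below x _ Cx); rewrite !dot_linear xx (dotC (nu c)) => h.
have := dot_le (x - c) (nu x); rewrite nu_unit // mulr1 dotBl.
by move=> h1; have : r * (1 - dot (nu x) (nu c)) <= r * 2^-1; [lra|rewrite ler_pM2l //; lra].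
Qed.

(** Moving a point that is below the hyperplane at c down by s brings it into the
ball at c, if it ends up at distance at most sqrt (r s) from c. *)
Let push c p u (s : R) : C c -> 2^-1 <= dot u (nu c) -> 0 <= s ->
  dot (p - c) (nu c) <= 0 -> enorm (p - s *: u - c) ^+ 2 <= r * s -> I (p - s *: u).
Proof.
move=> Cc uc s0 pc h; apply: (ball_in c) => //; rewrite /eball /= enorm_le ?(ltW r0) //.
have cc : dot (nu c) (nu c) = 1 by rewrite -enorm_sq nu_unit // expr1n.
set z := p - s *: u in h *.
have zc : dot (z - c) (nu c) = dot (p - c) (nu c) - s * dot u (nu c).
  by rewrite /z !dot_linear; ring.
have -> : z - (c - r *: nu c) = (z - c) + r *: nu c by rewrite opprB addrA addrAC.
move: (z - c) zc h => v zc h.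
rewrite !dot_linear (dotC (nu c)) zc cc -enorm_sq.
have : s * 2^-1 <= s * dot u (nu c) by rewrite ler_wpM2l.
set a := s * dot u (nu c); set b := dot (p - c) _ in pc *; set e := enorm _ ^+ 2 in h *.
move=> sa; have : r * (b - a) <= r * (- (s / 2)) by rewrite ler_wpM2l // ?(ltW r0) //; lra.
nra.
Qed.

(** Every set between I and U has its boundary within o(|h|^2) of that of I.  With
a contact point at distance eta |h| from x + h, the point of M above x + h has to
be pushed down by at most a multiple of eta^2 |h|^2 / r to reach I. *)
Lemma sandwich_height x M f : C x -> tangentially_dense C nu x ->
  M `<=` U -> I `<=` M ->
  boundary_graph M x (nu x) f -> forall e : R, 0 < e ->
  \forall h \near (0 : 'rV[R]_n), dot h (nu x) = 0 ->
    I (x + h - (f h + e * dot h h) *: nu x).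
Proof.
move=> Cx dx MU IM gf e e0.
have ux := nu_unit x Cx; set u := nu x in ux *.
(* The constant 9 comes from |z - c| <= 3 eta |h| below: the distance of c to x + h,
   the height t and the push s are each at most eta |h|. *)
pose eta := Num.min 1 (r * e / 9).
have eta0 : 0 < eta by rewrite lt_min ltr01 divr_gt0 ?mulr_gt0.
have eta1 : eta <= 1 by rewrite ge_min lexx.
have eta2 : eta <= r * e / 9 by rewrite ge_min lexx orbT.
have eta3 : eta ^+ 2 <= r * e / 9 by nra.
have [d d0 hd] := dx eta eta0.
have /near0_enormP[d1 d10 hd1] := gf.
pose m := Num.min (Num.min d d1) (Num.min (Num.min (r / 4) (eta * r)) (eta / e)).
apply/near0_enormP; exists m.
  by rewrite !lt_min d0 d10 !divr_gt0 ?mulr_gt0.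
move=> h; rewrite !lt_min => /andP[/andP[h1 h2] /andP[/andP[h3 h4] h5]] hu.
have [c Cc ch] := hd h hu h1.
have [Mf fmin] := hd1 h h2 hu.
have h0 := enorm_ge0 h; set w := enorm h in h0 h1 h2 h3 h4 h5 ch *.
have wr : w <= r by lra.
pose t := f h.
have tle : t <= eta * w.
  have : t <= w ^+ 2 / r.
    apply: fmin; apply: IM; apply: (ball_in x) => //; apply: mem_tangent_ball => //.
    have tr : (w ^+ 2 / r) * r = w ^+ 2 by rewrite divfK // gt_eqF.
    have : w ^+ 2 / r <= r by rewrite ler_pdivrMr //; nra.
    have : 0 <= w ^+ 2 / r by rewrite divr_ge0 ?sqr_ge0 // ltW.
    by rewrite -/w; nra.
  by move/le_trans; apply; rewrite ler_pdivrMr //; nra.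
have t0 : 0 <= t.
  have := below x _ Cx (MU _ Mf); rewrite -/u addrAC (addrC x) addrK !dot_linear hu.
  have uu : dot u u = 1 by rewrite -enorm_sq ux expr1n.
  by rewrite uu -/t; lra.
pose s := e * w ^+ 2.
have s0 : 0 <= s by rewrite mulr_ge0 ?sqr_ge0 // ltW.
have sle : s <= eta * w.
  by move: h5; rewrite ltr_pdivlMr // => h5; rewrite /s; nra.
have xc : enorm (x - c) <= r / 2.
  have -> : x - c = - (c - (x + h)) - h by rewrite opprB addrAC addrK.
  have ew : eta * w <= w by rewrite ler_piMl.
  by apply: le_trans (enormD _ _) _; rewrite !enormN -/w; lra.
have uc := normal_continuity x c Cx Cc xc.
rewrite -enorm_sq -/w -/s -/t scalerDl opprD addrA.
apply: (push c) => //; first exact: below Cc (MU _ Mf).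
set z := _ - c.
have : enorm z <= 3 * eta * w.
  have -> : z = - (c - (x + h)) - t *: u - s *: u.
    by rewrite /z opprB addrAC -[in LHS]addrA; apply/rowP => i; rewrite !mxE; ring.
  apply: le_trans (enormD _ _) _; apply: le_trans (lerD (enormD _ _) (lexx _)) _.
  by rewrite !enormN !enormZ ux !mulr1 !ger0_norm //; lra.
have z0 := enorm_ge0 z; move=> zw.
have : enorm z ^+ 2 <= (3 * eta * w) ^+ 2 by rewrite ler_pXn2r ?nnegrE // (le_trans z0).
move/le_trans; apply.
have -> : (3 * eta * w) ^+ 2 = 9 * eta ^+ 2 * w ^+ 2 by ring.
have -> : r * s = r * e * w ^+ 2 by rewrite /s; ring.
by rewrite ler_wpM2r ?sqr_ge0 //; lra.
Qed.

(** The graph of M' over the tangent hyperplane at x exists because M' is closed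
and contains a ball, and has the same expansion as that of M, by comparison of
both with I. *)
Lemma sandwich_principal_curvatures x M M' k : C x -> tangentially_dense C nu x ->
  I `<=` M -> M `<=` U -> I `<=` M' -> M' `<=` U -> closed M' ->
  is_principal_curvatures M x k -> is_principal_curvatures M' x k.
Proof.
move=> Cx dx IM MU IM' M'U cM' [u [f [A [nuM gf so AA cA]]]].
have eu : u = nu x.
  by apply: (outer_unit_normal_unique M x u (nu x) r) => //; [exact: nu_unit|
    apply: subset_trans IM; exact: ball_in].
subst u; have ux := nu_unit x Cx; have uu : dot (nu x) (nu x) = 1 by rewrite -enorm_sq ux expr1n.
pose fiber h : set R := [set t | M' (x + h - t *: nu x)].
pose f' h := inf (fiber h).
have gf' : boundary_graph M' x (nu x) f'.
  apply/near0_enormP; exists r => // h hr hu.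
  have lb t : fiber h t -> 0 <= t.
    move=> /M'U/(below x _ Cx); rewrite addrAC (addrC x) addrK !dot_linear hu uu; lra.
  have hinf : has_inf (fiber h).
    split; last by exists 0 => t; exact: lb.
    exists r; apply: IM'; apply: (ball_in x) => //; apply: mem_tangent_ball => //.
    by have := enorm_ge0 h; nra.
  split; last by move=> t ht; apply: ge_inf => //; case: hinf.
  suff : closure M' (x + h - f' h *: nu x) by rewrite -(proj1 (closure_id M') cM').
  apply/closure_enormP => e e0.
  have [t ht te] := inf_adherent e0 hinf; exists (x + h - t *: nu x) => //.
  have -> : x + h - t *: nu x - (x + h - f' h *: nu x) = (f' h - t) *: nu x.
    by apply/rowP => i; rewrite !mxE; ring.
  have ft : f' h <= t by apply: ge_inf => //; case: hinf.
  by rewrite enormZ ux mulr1 distrC ger0_norm ?subr_ge0 // ltrBlDl.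
exists (nu x), f', A; split => //.
  by split => // y /M'U; exact: below.
move=> e e0; have e2 : 0 < e / 2 by rewrite divr_gt0.
have /near0_enormP[d1 d10 h1] := sandwich_height x M f Cx dx MU IM gf _ e2.
have /near0_enormP[d2 d20 h2] := sandwich_height x M' f' Cx dx M'U IM' gf' _ e2.
have /near0_enormP[d3 d30 h3] := gf.
have /near0_enormP[d4 d40 h4] := gf'.
have /near0_enormP[d5 d50 h5] := so _ e2.
apply/near0_enormP; exists (Num.min (Num.min d1 d2) (Num.min (Num.min d3 d4) d5)).
  by rewrite !lt_min d10 d20 d30 d40.
move=> h; rewrite !lt_min => /andP[/andP[k1 k2] /andP[/andP[k3 k4] k5]] hu.
have := (h4 h k4 hu).2 _ (IM' _ (h1 h k1 hu)).
have := (h3 h k3 hu).2 _ (IM _ (h2 h k2 hu)).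
have := h5 h k5 hu; rewrite !ler_norml.
set q := dot (h *m A) h; set w := dot h h.
by move=> /andP[i1 i2] i3 i4; apply/andP; split; lra.
Qed.

End sandwich.

(** * The valuation property *)

Section valuation.
Context {R : realType} {s : nat}.
Local Notation n := s.+1.
Implicit Types (K L : set 'rV[R]_n) (x u v : 'rV[R]_n).

Lemma rolling_body_closed K : rolling_body K -> closed K.
Proof. by move=> [[cK _ _] _ _ _]; apply: compact_closed => //; exact: norm_hausdorff. Qed.

Lemma rolling_body_segment_closed K : rolling_body K -> segment_closed K.
Proof. by move=> [[_ cK _] _ _ _]; exact: convex_segment_closed. Qed.

Lemma eball_shrink x u (r r' : R) : 0 < r -> r <= r' -> enorm u = 1 ->
  eball (x - r *: u) r `<=` eball (x - r' *: u) r'.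
Proof.
move=> r0 rr u1 y; rewrite /eball /= => h.
have -> : y - (x - r' *: u) = (y - (x - r *: u)) + (r' - r) *: u.
  by apply/rowP => i; rewrite !mxE; ring.
apply: le_trans (enormD _ _) _; rewrite enormZ u1 mulr1 ger0_norm ?subr_ge0 //.
lra.
Qed.

(** If u and v differ, the midpoints between the two balls fill a neighbourhood
of x. *)
Lemma interior_of_two_balls M x u v (r : R) : segment_closed M -> 0 < r ->
  enorm u = 1 -> enorm v = 1 -> eball (x - r *: u) r `<=` M ->
  eball (x - r *: v) r `<=` M -> ~ M° x -> u = v.
Proof.
move=> cM r0 u1 v1 uM vM nM.
have uu : dot u u = 1 by rewrite -enorm_sq u1 expr1n.
have vv : dot v v = 1 by rewrite -enorm_sq v1 expr1n.
apply: contrapT => uv; apply: nM; apply/interior_enormP.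
have uv0 : 0 < dot (u - v) (u - v).
  by rewrite lt_neqAle dot_ge0 andbT eq_sym dot_eq0 subr_eq0; apply/eqP.
pose w := 2^-1 *: (u + v).
have w1 : enorm w < 1.
  rewrite enorm_lt // expr1n /w !dot_linear; move: uv0.
  by rewrite !dot_linear uu vv (dotC v u); lra.
exists (r * (1 - enorm w)); first by rewrite mulr_gt0 // subr_gt0.
move=> y yx.
have rw : enorm (r *: w + (y - x)) <= r.
  by apply: le_trans (enormD _ _) _; rewrite enormZ gtr0_norm //; lra.
pose p := x - r *: u + (r *: w + (y - x)); pose q := x - r *: v + (r *: w + (y - x)).
have Mp : M p by apply: uM; rewrite /eball /= /p addrC addKr.
have Mq : M q by apply: vM; rewrite /eball /= /q addrC addKr.
have -> : y = p + 2^-1 *: (q - p).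
  by apply/rowP => i; rewrite /p /q /w !mxE; field.
by apply: cM => //; lra.
Qed.

Lemma interior_subset_union K L x : K° x -> (K `|` L)° x.
Proof.
by move=> /interior_enormP[e e0 h]; apply/interior_enormP; exists e => // y /h Ky; left.
Qed.

Lemma closed_apart K x : closed K -> ~ K x ->
  exists2 e : R, 0 < e & forall y, enorm (y - x) < e -> ~ K y.
Proof.
move=> cK; rewrite (proj1 (closure_id K) cK) => /closure_enormP/existsNP[e /not_implyP[e0 h]].
by exists e => // y ye; rewrite -(proj1 (closure_id K) cK) => Ky; apply: h; exists y.
Qed.

Lemma agree_near_union_l K L x : closed L -> ~ L x -> agree_near K (K `|` L) x.
Proof.
move=> cL Lx; have [e e0 h] := closed_apart _ _ cL Lx; exists e => // y /h nL.
by split=> [|[]//]; left.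
Qed.

Lemma agree_near_inter_l K L x : L° x -> agree_near K (K `&` L) x.
Proof.
by move=> /interior_enormP[e e0 h]; exists e => // y /h Ly; split=> [|[]//].
Qed.

Section two_bodies.
Variables (K L : set 'rV[R]_n).
Hypotheses (bK : rolling_body K) (bL : rolling_body L).
Hypothesis cU : segment_closed (K `|` L).
Let U := K `|` L.
Let I := K `&` L.
Let C := boundary K `&` boundary L.

Let K_closed := rolling_body_closed K bK.
Let L_closed := rolling_body_closed L bL.
Let cK := rolling_body_segment_closed K bK.
Let cL := rolling_body_segment_closed L bL.
Let cI : segment_closed I := segment_closedI K L cK cL.
Let U_closed : closed U. Proof. exact: closedU. Qed.
Let I_closed : closed I. Proof. exact: closedI. Qed.

(** The ray from the origin leaves both bodies at x. *)
Let contact_boundary_union x : C x -> boundary U x.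
Proof.
move=> [/(boundary_closedE _ _ K_closed)[Kx nKx] /(boundary_closedE _ _ L_closed)[Lx nLx]].
apply/(boundary_closedE _ _ U_closed); split; first by left.
move=> /interior_enormP[e e0 h].
have x1 : 0 < enorm x + 1 by rewrite ltr_wpDl ?enorm_ge0.
pose t := e / 2 / (enorm x + 1); have t0 : 0 < t by rewrite !divr_gt0.
have : U ((1 + t) *: x).
  apply: h; rewrite scalerDl scale1r addrC addKr enormZ gtr0_norm // /t mulrAC ltr_pdivrMr //.
  by have := enorm_ge0 x; nra.
by case=> [Kt|Lt]; [apply: nKx|apply: nLx]; [apply: (interior_of_ray K x t)|
  apply: (interior_of_ray L x t)] => //; [case: bK|case: bL].
Qed.

(** A common normal and a common inner radius, uniform over the contact set. *)
Let contact_normals : exists2 r : R, 0 < r & exists nu : 'rV[R]_n -> 'rV[R]_n,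
  forall c, C c -> [/\ enorm (nu c) = 1, eball (c - r *: nu c) r `<=` I &
    forall y, U y -> dot (y - c) (nu c) <= 0].
Proof.
have [r1 r10 ball1] : inner_rolling_ball K by case: bK.
have [r2 r20 ball2] : inner_rolling_ball L by case: bL.
pose r := Num.min r1 r2; have r0 : 0 < r by rewrite lt_min r10.
have rr1 : r <= r1 by rewrite ge_min lexx.
have rr2 : r <= r2 by rewrite ge_min lexx orbT.
exists r => //.
suff /choice[nu Hnu] : forall c, exists u, C c -> [/\ enorm u = 1, eball (c - r *: u) r `<=` I &
    forall y, U y -> dot (y - c) u <= 0] by exists nu.
move=> c.
have [Cc|nCc] := pselect (C c); last by exists 0.
have [Kc Lc] := Cc.
have [u [u1 uK] uball] := ball1 c Kc; have [v [v1 vL] vball] := ball2 c Lc.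
have uballK : eball (c - r *: u) r `<=` K by apply: subset_trans uball; exact: eball_shrink.
have vballL : eball (c - r *: v) r `<=` L by apply: subset_trans vball; exact: eball_shrink.
have [_ nUc] := (boundary_closedE _ _ U_closed).1 (contact_boundary_union c Cc).
have uv : u = v.
  apply: (interior_of_two_balls U c u v r) => // y.
    by move/uballK; left.
  by move/vballL; right.
subst v; exists u => _; split => //.
  by move=> y yb; split; [exact: uballK|exact: vballL].
by move=> y [/uK|/vL].
Qed.

Variable k : nat.

Let contact_bounded : exists2 M : R, 0 <= M & forall c, C c -> enorm c <= M.
Proof.
have [[c0 Cc0]|nC] := pselect (exists c, C c); last first.
  by exists 0 => // c Cc; exfalso; apply: nC; exists c.
have [_ _ _ [r r0 outer]] := bK; have [u _ Ku] := outer c0 Cc0.1.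
exists (r + enorm (c0 - r *: u)); first by rewrite addr_ge0 ?enorm_ge0 // ltW.
move=> c [/(boundary_closedE _ _ K_closed)[Kc _] _].
rewrite -[c](subrK (c0 - r *: u)); apply: le_trans (enormD _ _) _.
by rewrite lerD2r; exact: Ku.
Qed.

Let null_set : exists N : set 'rV[R]_n, hausdorff s N = 0%E /\ forall x, C x -> ~ N x ->
  [/\ integrand_W1 k U x = integrand_W1 k K x, integrand_W1 k I x = integrand_W1 k K x &
      integrand_W1 k L x = integrand_W1 k K x].
Proof.
have [r r0 [nu Hnu]] := contact_normals; have [M M0 CM] := contact_bounded.
have nu1 c : C c -> enorm (nu c) = 1 by case/Hnu.
have ball_in c : C c -> eball (c - r *: nu c) r `<=` I by case/Hnu.
have below c y : C c -> U y -> dot (y - c) (nu c) <= 0 by case/Hnu => _ _; apply.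
have IU : I `<=` U by move=> x [Kx _]; left.
exists [set x | C x /\ ~ tangentially_dense C nu x]; split.
  apply: (not_tangentially_dense_null C nu r M) => // c c' y Cc Cc' /(ball_in c' Cc')/IU.
  exact: below.
move=> x Cx nNx; have dx : tangentially_dense C nu x.
  by apply: contrapT => h; apply: nNx.
have sand M1 M2 : I `<=` M1 -> M1 `<=` U -> I `<=` M2 -> M2 `<=` U -> closed M1 -> closed M2 ->
    integrand_W1 k M1 x = integrand_W1 k M2 x.
  move=> IM1 M1U IM2 M2U c1 c2; apply: integrand_W1_eq => c.
  by split; apply: (sandwich_principal_curvatures C I U nu r).
have IK : I `<=` K by move=> y [].
have IL : I `<=` L by move=> y [].
have KU : K `<=` U by move=> y; left.
have LU : L `<=` U by move=> y; right.
by split; apply: sand.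
Qed.

(** The set S collects the boundary points where the integrand of U is that of K
and the integrand of I is that of L; on the rest of the two boundaries they are
exchanged, and on the contact set all four agree outside N. *)
Lemma quermass_W1_union_inter :
  (quermass_W1 k (K `|` L) + quermass_W1 k (K `&` L) = quermass_W1 k K + quermass_W1 k L)%E.
Proof.
have [N [N0 eqC]] := null_set.
have bdK x := boundary_closedE K x K_closed; have bdL x := boundary_closedE L x L_closed.
have bdU x := boundary_closedE U x U_closed; have bdI x := boundary_closedE I x I_closed.
have UC : U = L `|` K by rewrite /U setUC.
have IC : I = L `&` K by rewrite /I setIC.
pose S := ((K `\` K°) `\` L) `|` ((L `\` L°) `&` K°).
rewrite !quermass_W1E.
have closed_meas (F : set 'rV[R]_n) : closed F -> (hausdorff s).-caratheodory F.
  exact: closed_caratheodory.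
have open_meas (F : set 'rV[R]_n) : open F -> (hausdorff s).-caratheodory F.
  move=> oF; rewrite -[F]setCK; apply/caratheodory_measurable_setC/closed_meas.
  exact: open_closedC.
have mK := closed_meas _ K_closed; have mL := closed_meas _ L_closed.
have mKi := open_meas _ (@open_interior _ K); have mLi := open_meas _ (@open_interior _ L).
apply: (@integral_swap _ _ _ _ _ _ _ _ (S : set (caratheodory_type (@hausdorff R n s))) N) => //.
- apply: caratheodory_measurable_setU.
    by do 2?apply: caratheodory_measurable_setD.
  by apply: caratheodory_measurable_setI => //; apply: caratheodory_measurable_setD.
- exact: null_caratheodory.
- move=> x nNx [[[Kx nKx] nLx]|[[Lx nLx] Kx]].
    (* x is outside L: the union coincides with K near x *)
    have KU := agree_near_union_l K L x L_closed nLx.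
    have bKx : boundary K x by apply/bdK.
    have bUx := agree_near_boundary _ _ _ KU bKx.
    have nIx : ~ boundary I x by move/bdI => [[]].
    have nbLx : ~ boundary L x by move/bdL => [].
    by rewrite -/U -/I /patch (memNset nIx) (memNset nbLx) (mem_set bUx) (mem_set bKx) /=
      (integrand_W1_local k K U x cK cU Kx KU).
  (* x is inside K: the intersection coincides with L near x *)
  have LI := agree_near_inter_l L K x Kx.
  have bLx : boundary L x by apply/bdL.
  have bIx := agree_near_boundary _ _ _ LI bLx.
  have nUx : ~ boundary U x by move/bdU => [_]; apply; exact: interior_subset_union.
  have nbKx : ~ boundary K x by move/bdK => [].
  rewrite -IC in LI bIx.
  by rewrite -/U -/I /patch (memNset nUx) (memNset nbKx) (mem_set bIx) (mem_set bLx) /=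
    (integrand_W1_local k L I x cL cI Lx LI).
move=> x nNx nSx.
have [bKx|nbKx] := pselect (boundary K x).
  have [Kx nKx] := (bdK x).1 bKx.
  have Lx : L x by apply: contrapT => nLx; apply: nSx; left.
  have [Lix|nLix] := pselect (L° x).
    have KI := agree_near_inter_l K L x Lix.
    have bIx := agree_near_boundary _ _ _ KI bKx.
    have nUx : ~ boundary U x by move/bdU => [_]; apply; rewrite UC; exact: interior_subset_union.
    have nbLx : ~ boundary L x by move/bdL => [].
    by rewrite -/U -/I /patch (memNset nUx) (memNset nbLx) (mem_set bIx) (mem_set bKx) /=
      (integrand_W1_local k K I x cK cI Kx KI).
  have bLx : boundary L x by apply/bdL.
  (* x is a contact point outside N *)
  have bUx := contact_boundary_union x (conj bKx bLx).
  have bIx : boundary I x.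
    apply/bdI; split=> // /interior_enormP[e e0 h]; apply: nKx; apply/interior_enormP.
    by exists e => // y /h[].
  have [eU eI eL] := eqC x (conj bKx bLx) nNx.
  by rewrite -/U -/I /patch (mem_set bUx) (mem_set bIx) (mem_set bKx) (mem_set bLx) /= eU eI eL.
have [bLx|nbLx] := pselect (boundary L x).
  have [Lx nLx] := (bdL x).1 bLx.
  have nKx : ~ K x.
    move=> Kx; have [Kix|nKix] := pselect (K° x); first by apply: nSx; right.
    by apply: nbKx; apply/bdK.
  have LU := agree_near_union_l L K x K_closed nKx.
  have bUx := agree_near_boundary _ _ _ LU bLx.
  rewrite -UC in LU bUx.
  have nIx : ~ boundary I x by move/bdI => [[]].
  by rewrite -/U -/I /patch (memNset nIx) (memNset nbKx) (mem_set bUx) (mem_set bLx) /=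
    (integrand_W1_local k L U x cL cU Lx LU).
have inK : K x -> K° x by move=> Kx; apply: contrapT => h; apply: nbKx; apply/bdK.
have inL : L x -> L° x by move=> Lx; apply: contrapT => h; apply: nbLx; apply/bdL.
have nUx : ~ boundary U x.
  move/bdU => [[/inK Kx|/inL Lx]]; apply; first exact: interior_subset_union.
  by rewrite UC; exact: interior_subset_union.
have nIx : ~ boundary I x.
  move/bdI => [[/inK/interior_enormP[e e0 h] /inL/interior_enormP[d d0 hd]]]; apply.
  apply/interior_enormP; exists (Num.min e d); first by rewrite lt_min e0.
  by move=> y; rewrite lt_min => /andP[/h Ky /hd Ly].
by rewrite -/U -/I /patch (memNset nUx) (memNset nIx) (memNset nbKx) (memNset nbLx).
Qed.

End two_bodies.
End valuation.

Lemma steiner_V1E (R : realType) (n k : nat) (K : set 'rV[R]_n) :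
  steiner_V 1 k K = quermass_W1 k K.
Proof.
rewrite /steiner_V subrr mulr0 mul0r big_ord_recr /= subnn.
rewrite big1 ?add0e => [|i _]; last first.
  rewrite /gen_binom (_ : \prod_(_ < _) _ = 0) ?mul0r ?mul0e //.
  have : (0 < k - i)%N by rewrite subn_gt0.
  by case: (k - i)%N => // m _; rewrite big_ord_recl subrr mul0r.
rewrite /gen_binom big_ord0 divr1 mul1e.
rewrite /quermass_W /quermass_W1; apply: eq_integral => x _; congr EFin.
by rewrite !subrr mulr0 mul0r addr0 powRr0 mul1r.
Qed.

Theorem mainTheorem2 (R : realType) (n : nat) (hn : (2 <= n)%N)
    (k : nat) (hk : (0 < k)%N) :
  [/\ forall K : set 'rV[R]_n, rolling_body K ->
        steiner_V 1 k K = quermass_W1 k K,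
      forall (K : set 'rV[R]_n) (phi : 'rV[R]_n -> 'rV[R]_n),
        rolling_body K -> rigid_motion phi ->
        quermass_W1 k (phi @` K) = quermass_W1 k K,
      forall (K : set 'rV[R]_n) (a : R), rolling_body K -> 0 < a ->
        quermass_W1 k [set a *: x | x in K] =
        ((a `^ (n%:R * ((n%:R - 1) / (n%:R + 1)) - k%:R))%:E *
          quermass_W1 k K)%E
    & is_valuation (@rolling_body R n) (@quermass_W1 R n k)].
Proof.
have n0 : (0 < n)%N by exact: leq_trans hn.
split.
- by move=> K _; exact: steiner_V1E.
- move=> K phi [_ _ irb _] /rigid_motion_similitude[Q [b [QQ ->]]].
  by rewrite quermass_W1_similitude // powR1 mul1e.
- move=> K a [_ _ irb _] a0.
  have -> : [set a *: x | x in K] = similitude a 1%:M 0 @` K.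
    by apply: eq_imagel => x _; rewrite /similitude mulmx1 addr0.
  by apply: quermass_W1_similitude => //; rewrite trmx1 mulmx1.
- case: n hn n0 => [//|s] _ _ K L bK bL cU.
  by apply: quermass_W1_union_inter => //; exact: convex_segment_closed.
Qed.
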